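(* Let $k$ be an algebraically closed field of characteristic $p\ge 0$ and let $X$ be a hyperelliptic curve over $k$ of genus $g\ge 2$, with function field $K(X)=k(x,y)$ given by a defining equation as described in the context. If $p \neq 2$, the residue classes $$\gamma_i:= \left[ \left( \frac{\psi_i(x)}{2x^{i+1}y} dx, \frac{-\phi_i(x)}{2x^{i+1}y} dx, \frac{y}{x^i} \right)\right] , \quad i=1, \ldots ,g,$$ along with the residue classes $$\lambda_i:= \left[ \left( \frac{x^{i}}{y} dx , \frac{x^{i}}{y} dx, 0 \right)\right] , \quad i = 0,\ldots ,g-1,$$ form a $k$-basis of $H^1_{\mathrm{dR}}(X/k)$. On the other hand, if $p=2$, the residue classes $$\gamma_i := \left[ \left( \frac{\psi_i(x,y)}{x^{i+1}h(x)} dx, \frac{\phi_i(x,y)}{x^{i+1}h(x)} dx, \frac{y}{x^i} \right)\right], \quad i =1, \ldots , g,$$ together with the residue classes $$\lambda_i := \left[ \left( \frac{x^{i}}{h(x)} dx, \frac{x^{i}}{h(x)} dx, 0 \right)\right], \quad i=0, \ldots, g-1,$$ form a $k$-basis of $H^1_{\mathrm{dR}}(X/k)$.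
   Context: Curves are smooth, projective and irreducible. A curve $X$ over $k$ is hyperelliptic if there is a finite separable morphism $\pi\colon X\to\mathbb{P}^1_k$ of degree two; fix such $\pi$, corresponding to the extension of function fields $K(X)/k(x)$. Defining equation. If $p\ne 2$: $K(X)=k(x,y)$ with $y^2=f(x)$ for a monic polynomial $f\in k[x]$ without repeated roots, of degree $2g+1$ if $\infty$ is a branch point of $\pi$ and of degree $2g+2$ otherwise. If $p=2$: $K(X)=k(x,y)$ with $y^2-h(x)y=f(x)$ for polynomials $h,f\in k[x]$ such that $h'(x)^2f(x)+f'(x)^2$ and $h(x)$ have no common roots in $k$; moreover $\deg f\le 2g+2$ and $\deg h\le g+1$, with $\deg h=g+1$ if and only if $\infty$ is not a branch point of $\pi$. De-Rham cohomology. For $a\in\mathbb{P}^1_k$ let $U_a=X\setminus\pi^{-1}(a)$. $H^1_{\mathrm{dR}}(X/k)$ is the first hypercohomology of $\mathcal{O}_X\xrightarrow{d}\Omega_X$; via Čech cohomology for the affine cover $\{U_0,U_\infty\}$ it is identified with the quotient of the space $$\{(\omega_0,\omega_\infty,f_{0\infty})\in\Omega_X(U_0)\times\Omega_X(U_\infty)\times\mathcal{O}_X(U_0\cap U_\infty) \mid df_{0\infty}=\omega_0|_{U_0\cap U_\infty}-\omega_\infty|_{U_0\cap U_\infty}\}$$ by the subspace $$\{(df_0,df_\infty,f_0|_{U_0\cap U_\infty}-f_\infty|_{U_0\cap U_\infty}) \mid f_0\in\mathcal{O}_X(U_0),\ f_\infty\in\mathcal{O}_X(U_\infty)\}.$$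 Brackets $[\,\cdot\,]$ denote residue classes in this quotient; the assertion includes that the given triples lie in the space $\{(\omega_0,\omega_\infty,f_{0\infty})\in\Omega_X(U_0)\times\Omega_X(U_\infty)\times\mathcal{O}_X(U_0\cap U_\infty) \mid df_{0\infty}=\omega_0|_{U_0\cap U_\infty}-\omega_\infty|_{U_0\cap U_\infty}\}$. Polynomials. For $u(x)=a_0+\dots+a_nx^n\in k[x]$ and $m\ge 0$ put $u^{\le m}(x):=a_0+\dots+a_mx^m$ and $u^{>m}(x):=a_{m+1}x^{m+1}+\dots+a_nx^n$. Let $1\le i\le g$. If $p\ne2$: $s_i(x):=xf'(x)-2if(x)$, $\psi_i(x):=s_i^{\le i}(x)$, $\phi_i(x):=s_i^{>i}(x)$. If $p=2$: $s_i(x,y):=xf'(x)+(xh'(x)+ih(x))y\in k[x]\oplus k[x]y$, $\psi_i(x,y):=s_i^{\le i}(x,y)$ and $\phi_i(x,y):=s_i^{>i}(x,y)$, where the operations $\le i$ and $>i$ are applied to both coefficients $xf'(x)$ and $xh'(x)+ih(x)$, i.e. $\psi_i=(xf')^{\le i}+(xh'+ih)^{\le i}y$ and $\phi_i=(xf')^{>i}+(xh'+ih)^{>i}y$. *)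

(* Defs.v *)
From HB Require Import structures.
From mathcomp Require Import all_boot all_order all_algebra all_field.
From mathcomp Require Import boolp.

Set Implicit Arguments.
Unset Strict Implicit.
Unset Printing Implicit Defensive.

Import GRing.Theory.
Local Open Scope ring_scope.
Local Open Scope quotient_scope.

(** * Modules, quotients and bases *)

(* A finite family is a basis; unlike [basis_of] from vector.v, the ambient
   module is not assumed to be finite dimensional beforehand. *)
Definition is_basis (k : fieldType) (V : lmodType k) (J : finType)
    (v : J -> V) : Prop :=
  (forall c : J -> k, \sum_j c j *: v j = 0 -> forall j, c j = 0) /\
  (forall w : V, exists c : J -> k, w = \sum_j c j *: v j).

Section QuotientModule.
Variables (k : fieldType) (V : lmodType k) (B : pred V).
Hypothesis B_closed : submod_closed B.

(* [B], packaged so that the closure instances can be inferred. *)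
Definition submod_pred of submod_closed B : {pred V} := B.
HB.instance Definition _ (BP : submod_closed B) :=
  GRing.isSubmodClosed.Build k V (submod_pred BP) BP.
Local Notation quotB := (@Quotient.quot V (submod_pred B_closed)).

Definition quotmod : Type := quotB.
HB.instance Definition _ := GRing.Zmodule.copy quotmod quotB.

Definition qclass (v : V) : quotmod := \pi_quotB v.

Lemma qclassP (v w : V) : qclass v = qclass w <-> v - w \in B.
Proof.
have -> : (v - w \in B) = (v - w \in submod_pred B_closed) by [].
by rewrite Quotient.idealrBE; split=> [/eqP|/eqP].
Qed.

Lemma qclassD (v w : V) : qclass (v + w) = qclass v + qclass w.
Proof. exact: Quotient.pi_add. Qed.

Lemma qclass_repr (q : quotmod) : qclass (repr (q : quotB)) = q.
Proof. exact: reprK. Qed.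

Definition quot_scale (c : k) (q : quotmod) : quotmod :=
  qclass (c *: repr (q : quotB)).

Lemma qclassZ (c : k) (v : V) : qclass (c *: v) = quot_scale c (qclass v).
Proof.
apply/qclassP; rewrite -scalerBr.
apply: (@rpredZ _ _ (submod_pred B_closed)).
by apply/qclassP; rewrite qclass_repr.
Qed.

Fact quot_scaleA (a b : k) (q : quotmod) :
  quot_scale a (quot_scale b q) = quot_scale (a * b) q.
Proof. by rewrite -[q]qclass_repr -!qclassZ scalerA. Qed.

Fact quot_scale1 : left_id 1 quot_scale.
Proof. by move=> q; rewrite -[q]qclass_repr -qclassZ scale1r. Qed.

Fact quot_scaleDr : right_distributive quot_scale +%R.
Proof.
move=> c q r; rewrite -[q]qclass_repr -[r]qclass_repr.
by rewrite -qclassD -!qclassZ -qclassD scalerDr.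
Qed.

Fact quot_scaleDl (q : quotmod) : {morph quot_scale^~ q : a b / a + b}.
Proof.
by move=> a b /=; rewrite -[q]qclass_repr -!qclassZ -qclassD scalerDl.
Qed.

HB.instance Definition _ := GRing.Zmodule_isLmodule.Build k quotmod
  quot_scaleA quot_scale1 quot_scaleDr quot_scaleDl.

End QuotientModule.

(** * Curves through their function fields *)

(* The smooth projective curve X, together with pi : X -> P^1, is given by
   the extension K = K(X) of the rational function field k(x). *)

Section Curve.
Variables (k : closedFieldType) (K : fieldExtType {fraction {poly k}}).

(* The image u(x) of u under k[x] -> k(x) -> K. *)
Definition evx : {poly k} -> K :=
  in_alg K \o @FracField.tofrac {poly k}.
HB.instance Definition _ := GRing.RMorphism.on evx.

Definition cst : k -> K := evx \o polyC.
HB.instance Definition _ := GRing.RMorphism.on cst.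

Definition xK : K := evx 'X.

Definition hyperelliptic : Prop :=
  \dim {:K} = 2%N /\ separable 1%VS {:K}%VS.

(* The closed points of X are the nontrivial valuation rings of K/k; the
   valuation ring is the local ring O_{X,P} of the point. They are all
   discrete since K has transcendence degree 1 over k. *)
Record point := Point {
  stalk : K -> Prop;
  stalk_cst : forall c : k, stalk (cst c);
  stalkB : forall a b, stalk a -> stalk b -> stalk (a - b);
  stalkM : forall a b, stalk a -> stalk b -> stalk (a * b);
  stalk_val : forall a, stalk a \/ stalk a^-1;
  stalk_proper : exists a, ~ stalk a
}.

Definition maximal_ideal (P : point) (a : K) : Prop :=
  stalk P a /\ ~ (exists2 b, stalk P b & a * b = 1).

Definition uniformizer (P : point) (t : K) : Prop :=
  forall a, maximal_ideal P a <-> exists2 b, stalk P b & a = b * t.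

Definition P1 : Type := option k.
Definition infty : P1 := None.
Definition origin : P1 := Some 0.

(* The pullback along pi of a local parameter of P^1 at a. *)
Definition P1_param (a : P1) : K :=
  if a is Some c then xK - cst c else xK^-1.

(* The relation pi(P) = a. *)
Definition lies_over (P : point) (a : P1) : Prop :=
  maximal_ideal P (P1_param a).

Definition branch_point (a : P1) : Prop :=
  exists2 P, lies_over P a & ~ uniformizer P (P1_param a).

Definition Uof (a : P1) (P : point) : Prop := ~ lies_over P a.

Definition Ucap (P : point) : Prop := Uof origin P /\ Uof infty P.

(* The sections over U of the subsheaf O_X of the constant sheaf K, for U
   nonempty and open; restriction maps are then inclusions. *)
Definition functions_on (U : point -> Prop) (z : K) : Prop :=
  forall P, U P -> stalk P z.

(** ** Differentials *)

Definition is_derivation (M : lmodType K) (D : K -> M) : Prop :=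
  [/\ forall a b, D (a + b) = D a + D b,
      forall a b, D (a * b) = a *: D b + b *: D a
    & forall c : k, D (cst c) = 0].

(* The module of Kaehler differentials of K/k with its universal
   k-derivation. *)
Record kaehler := Kaehler {
  Omega :> lmodType K;
  diff : K -> Omega;
  diff_der : is_derivation diff;
  diff_universal : forall (M : lmodType K) (D : K -> M), is_derivation D ->
    exists2 phi : {linear Omega -> M}, (forall a, phi (diff a) = D a)
      & forall psi : {linear Omega -> M},
          (forall a, psi (diff a) = D a) -> psi =1 phi
}.

Variable Om : kaehler.
Local Notation d := (@diff Om).

(* The stalk of Omega_X at P, as the O_{X,P}-submodule of Omega_{K/k}
   generated by the differentials of elements of O_{X,P}. *)
Definition stalk_diff (P : point) (w : Om) : Prop :=
  exists2 s : seq (K * K),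
    (forall j, j \in s -> stalk P j.1 /\ stalk P j.2)
    & w = \sum_(j <- s) j.1 *: d j.2.

Definition diffs_on (U : point -> Prop) (w : Om) : Prop :=
  forall P, U P -> stalk_diff P w.

(** ** Restriction of scalars along k -> K *)

Definition restr (W : lmodType K) : Type := W.
HB.instance Definition _ (W : lmodType K) := GRing.Zmodule.copy (restr W) W.

Section Restr.
Variable W : lmodType K.

Definition restr_scale (c : k) (w : restr W) : restr W := cst c *: (w : W).

Fact restr_scaleA (a b : k) (w : restr W) :
  restr_scale a (restr_scale b w) = restr_scale (a * b) w.
Proof. by rewrite /restr_scale scalerA rmorphM. Qed.

Fact restr_scale1 : left_id 1 restr_scale.
Proof. by move=> w; rewrite /restr_scale rmorph1 scale1r. Qed.

Fact restr_scaleDr : right_distributive restr_scale +%R.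
Proof. by move=> c v w; rewrite /restr_scale scalerDr. Qed.

Fact restr_scaleDl (w : restr W) : {morph restr_scale^~ w : a b / a + b}.
Proof. by move=> a b; rewrite /restr_scale rmorphD scalerDl. Qed.

HB.instance Definition _ := GRing.Zmodule_isLmodule.Build k (restr W)
  restr_scaleA restr_scale1 restr_scaleDr restr_scaleDl.

Lemma restrZE (c : k) (w : restr W) : c *: w = cst c *: (w : W) :> W.
Proof. by []. Qed.

End Restr.

(** ** Closure properties *)

Lemma stalk0 P : stalk P 0.
Proof. by rewrite -(rmorph0 cst); apply: stalk_cst. Qed.

Lemma stalkN P a : stalk P a -> stalk P (- a).
Proof. by move=> Pa; rewrite -sub0r; apply: stalkB => //; apply: stalk0. Qed.

Lemma functions_on0 U : functions_on U 0.
Proof. by move=> P _; apply: stalk0. Qed.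

Lemma functions_onZD U (c : k) a b :
  functions_on U a -> functions_on U b -> functions_on U (cst c * a + b).
Proof.
move=> Ua Ub P UP; rewrite -[b]opprK; apply: stalkB; last first.
  by apply: stalkN; apply: Ub.
by apply: stalkM; [apply: stalk_cst | apply: Ua].
Qed.

Lemma diffs_on0 U : diffs_on U 0.
Proof. by move=> P _; exists [::] => //; rewrite big_nil. Qed.

Lemma diffs_onZD U (c : k) v w :
  diffs_on U v -> diffs_on U w -> diffs_on U (cst c *: v + w).
Proof.
move=> Uv Uw P UP; have [s sP ->] := Uv P UP; have [t tP ->] := Uw P UP.
exists ([seq (cst c * j.1, j.2) | j <- s] ++ t) => [j|].
  rewrite mem_cat => /orP[/mapP[i /sP[i1 i2] ->]|/tP//]; split=> //=.
  by apply: stalkM => //; apply: stalk_cst.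
rewrite big_cat big_map scaler_sumr /=; congr (_ + _).
by apply: eq_bigr => j _; rewrite scalerA.
Qed.

Lemma diff0 : d 0 = 0.
Proof. by have [_ _ dc] := diff_der Om; rewrite -(rmorph0 cst) dc. Qed.

Lemma diffZD (c : k) a b : d (cst c * a + b) = cst c *: d a + d b.
Proof.
by have [dD dM dc] := diff_der Om; rewrite dD dM dc scaler0 addr0.
Qed.

(** ** Genus *)

Definition H0Omega_pred : pred (restr Om) :=
  fun w => `[< diffs_on (fun=> True) w >].

Fact H0Omega_closed : submod_closed H0Omega_pred.
Proof.
split=> [|c v w]; rewrite !unfold_in; first by apply/asboolP; apply: diffs_on0.
by move=> /asboolP vP /asboolP wP; apply/asboolP; apply: diffs_onZD.
Qed.
HB.instance Definition _ :=
  GRing.isSubmodClosed.Build k (restr Om) H0Omega_pred H0Omega_closed.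

Definition H0Omega : Type := {w : restr Om | w \in H0Omega_pred}.
HB.instance Definition _ := SubChoice.on H0Omega.
HB.instance Definition _ := [SubChoice_isSubLmodule of H0Omega by <:].

Definition has_genus (g : nat) : Prop :=
  exists v : 'I_g -> H0Omega, is_basis v.

(** ** De Rham cohomology *)

Definition triple : Type := (restr Om * restr Om * restr K^o)%type.
HB.instance Definition _ := GRing.Lmodule.on triple.

Definition dR_cocycle (t : triple) : Prop :=
  let: (w0, woo, z) := t in
  [/\ diffs_on (Uof origin) w0, diffs_on (Uof infty) woo,
      functions_on Ucap z & d z = w0 - woo].

Definition dR_coboundary (t : triple) : Prop :=
  exists z0 zoo : K,
    [/\ functions_on (Uof origin) z0, functions_on (Uof infty) zoo
      & t = (d z0, d zoo, z0 - zoo)].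

Definition Z1dR_pred : pred triple := fun t => `[< dR_cocycle t >].

Fact Z1dR_closed : submod_closed Z1dR_pred.
Proof.
split=> [|c [[v0 voo] y] [[w0 woo] z]]; rewrite !unfold_in.
  apply/asboolP; split; [exact: diffs_on0|exact: diffs_on0| |].
    exact: functions_on0.
  by rewrite subrr; exact: diff0.
move=> /asboolP[v0P vooP yP dy] /asboolP[w0P wooP zP dz]; apply/asboolP.
split; [exact: diffs_onZD|exact: diffs_onZD|exact: functions_onZD|].
transitivity (cst c *: d y + d z); first exact: diffZD.
by rewrite dy dz scalerBr addrACA -opprD.
Qed.
HB.instance Definition _ :=
  GRing.isSubmodClosed.Build k triple Z1dR_pred Z1dR_closed.

Definition Z1dR : Type := {t : triple | t \in Z1dR_pred}.
HB.instance Definition _ := SubChoice.on Z1dR.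
HB.instance Definition _ := [SubChoice_isSubLmodule of Z1dR by <:].

Definition B1dR_pred : pred Z1dR := fun t => `[< dR_coboundary (val t) >].

Fact B1dR_closed : submod_closed B1dR_pred.
Proof.
split=> [|c v w]; rewrite !unfold_in.
  apply/asboolP; exists 0, 0.
  split; [exact: functions_on0|exact: functions_on0|].
  by rewrite diff0 subrr.
move=> /asboolP[y0 [yoo [y0P yooP vE]]] /asboolP[z0 [zoo [z0P zooP wE]]].
apply/asboolP; exists (cst c * y0 + z0), (cst c * yoo + zoo).
split; [exact: functions_onZD|exact: functions_onZD|].
have -> : val (c *: v + w) = c *: val v + val w by [].
rewrite vE wE !diffZD opprD addrACA -mulrBr; congr (_, _, _).
Qed.
Definition H1dR : lmodType k := quotmod B1dR_closed.

Definition dR_class (t : triple) (tZ : dR_cocycle t) : H1dR :=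
  qclass B1dR_closed (exist _ t (asboolT tZ) : Z1dR).

Definition mktriple (w0 woo : Om) (z : K) : triple := (w0, woo, z).

(** ** Defining equations *)

(* Recall that [size f] is the degree of f plus one. *)
Definition defining_eq (g : nat) (y : K) (f : {poly k}) : Prop :=
  [/\ <<1; y>>%VS = {:K}%VS, y ^+ 2 = evx f, f \is monic,
      forall a : k, ~~ (('X - a%:P) ^+ 2 %| f)
    & (branch_point infty -> size f = (2 * g + 1).+1) /\
      (~ branch_point infty -> size f = (2 * g + 2).+1)].

Definition defining_eq2 (g : nat) (y : K) (h f : {poly k}) : Prop :=
  [/\ <<1; y>>%VS = {:K}%VS, y ^+ 2 - evx h * y = evx f,
      forall a : k, ~ (root (h^`() ^+ 2 * f + f^`() ^+ 2) a /\ root h a),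
      (size f <= (2 * g + 2).+1)%N
    & (size h <= (g + 1).+1)%N /\
      (size h = (g + 1).+1 <-> ~ branch_point infty)].

(** ** The triples *)

(* The truncations written with exponents <= m and > m. *)
Definition upto (m : nat) (u : {poly k}) : {poly k} := \poly_(j < m.+1) u`_j.
Definition above (m : nat) (u : {poly k}) : {poly k} :=
  \poly_(j < size u) (if (m < j)%N then u`_j else 0).

Definition s_ (f : {poly k}) (i : nat) : {poly k} :=
  'X * f^`() - (2 * i)%:R *: f.
Definition psi_ f i : K := evx (upto i (s_ f i)).
Definition phi_ f i : K := evx (above i (s_ f i)).

Definition gamma_triple (y : K) (f : {poly k}) (i : nat) : triple :=
  mktriple ((psi_ f i / (2%:R * xK ^+ i.+1 * y)) *: d xK)
           ((- phi_ f i / (2%:R * xK ^+ i.+1 * y)) *: d xK)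
           (y / xK ^+ i).

Definition lambda_triple (y : K) (i : nat) : triple :=
  mktriple ((xK ^+ i / y) *: d xK) ((xK ^+ i / y) *: d xK) 0.

(* The coefficients of 1 and y in s_i(x, y). *)
Definition s2_ (h f : {poly k}) (i : nat) : {poly k} * {poly k} :=
  ('X * f^`(), 'X * h^`() + i%:R *: h).
Definition psi2_ y h f i : K :=
  evx (upto i (s2_ h f i).1) + evx (upto i (s2_ h f i).2) * y.
Definition phi2_ y h f i : K :=
  evx (above i (s2_ h f i).1) + evx (above i (s2_ h f i).2) * y.

Definition gamma2_triple (y : K) (h f : {poly k}) (i : nat) : triple :=
  mktriple ((psi2_ y h f i / (xK ^+ i.+1 * evx h)) *: d xK)
           ((phi2_ y h f i / (xK ^+ i.+1 * evx h)) *: d xK)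
           (y / xK ^+ i).

Definition lambda2_triple (h : {poly k}) (i : nat) : triple :=
  mktriple ((xK ^+ i / evx h) *: d xK) ((xK ^+ i / evx h) *: d xK) 0.

(* The index i : 'I_g stands for gamma_(i+1) on the left and lambda_i on the
   right. *)
Definition classes_form_basis (g : nat) (gamma lambda : nat -> triple) : Prop :=
  exists (gammaZ : forall i : 'I_g, dR_cocycle (gamma i.+1))
         (lambdaZ : forall i : 'I_g, dR_cocycle (lambda i)),
    is_basis (fun j : 'I_g + 'I_g =>
      match j with
      | inl i => dR_class (gammaZ i)
      | inr i => dR_class (lambdaZ i)
      end).

End Curve.

(* Main.v *)
(** Write the curve as [y^2 = h(x) y + f(x)] in every characteristic, with
    [h = 0] when [p <> 2]; then [eta = dx / (2 y - h)] is, up to a scalar, the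
    differential of the statement, and [d z = D(z) eta] for the derivation [D]
    with [D x = 2 y - h].  Near a point of the fibre over [a] the identity
    [(y - b) (y - h + b) = (x - a) q(x)], with [q(a) = h'(a) b + f'(a)], shows
    that smoothness of the plane model makes every local ring a localisation
    of [k[x] + k[x] y].  Hence functions regular away from infinity form
    [A = k[x] + k[x] y], regular differentials there form [A eta], and the
    model [(1/x, y/x^(g+1))] gives [A' = k[1/x] + k[1/x] y/x^(g+1)] and
    [x^(g-1) A' eta] away from [x = 0].  Everything is now a computation with
    Laurent polynomials: [H^0(Omega)] is spanned by the [x^i eta], [i < g], and
    a function regular away from [0] and infinity is a unique combination of
    the [y / x^i], [1 <= i <= g], modulo [A + A'].

    The points needed to detect regularity come from Chevalley's extension
    theorem.  The model is smooth at infinity because otherwise a translation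
    [y - b x^(g+1)] yields a model for a smaller [g], contradicting the
    dimension of [H^0(Omega)]. *)

From HB Require Import structures.
From mathcomp Require Import all_boot all_order all_algebra all_field.
From mathcomp Require Import boolp classical_sets.
From mathcomp Require Import ring zify.
Require Import Defs.

Set Implicit Arguments.
Unset Strict Implicit.
Unset Printing Implicit Defensive.

Import GRing.Theory.
Local Open Scope ring_scope.

(** * Valuation rings and Chevalley's theorem *)

Section Valuation.
Variables (k : closedFieldType) (K : fieldExtType {fraction {poly k}}).
Implicit Types (P : point K) (a b z : K).

Lemma stalk1 P : stalk P 1.
Proof. by rewrite -(rmorph1 (cst K)); apply: stalk_cst. Qed.

Lemma stalkD P a b : stalk P a -> stalk P b -> stalk P (a + b).
Proof.
by move=> Pa Pb; rewrite -[b]opprK; apply: stalkB => //; apply: stalkN.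
Qed.

Lemma stalkX P a n : stalk P a -> stalk P (a ^+ n).
Proof.
move=> Pa; elim: n => [|n IH]; first exact: stalk1.
by rewrite exprS; apply: stalkM.
Qed.

Lemma stalk_sum P (I : Type) (r : seq I) (Q : pred I) (F : I -> K) :
  (forall i, Q i -> stalk P (F i)) -> stalk P (\sum_(i <- r | Q i) F i).
Proof.
by move=> FP; elim/big_ind: _ => //; [apply: stalk0 | apply: stalkD].
Qed.

Lemma maximal_idealE P a :
  maximal_ideal P a <-> stalk P a /\ (a <> 0 -> ~ stalk P a^-1).
Proof.
split=> -[Pa na]; split=> //.
  by move=> /eqP a0 Pa'; apply: na; exists a^-1; rewrite ?divff.
move=> -[b Pb ab]; have a0 : a <> 0.
  by move=> a0; move/eqP: ab; rewrite a0 mul0r eq_sym oner_eq0.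
apply: (na a0); suff -> : a^-1 = b by [].
by apply: (mulfI (x := a)); [apply/eqP | rewrite ab divff//; apply/eqP].
Qed.

Lemma maximal_ideal0 P : maximal_ideal P 0.
Proof. by apply/maximal_idealE; split=> //; apply: stalk0. Qed.

Lemma maximal_ideal_stalk P a : maximal_ideal P a -> stalk P a.
Proof. by case. Qed.

Lemma maximal_ideal_unit P a b :
  maximal_ideal P a -> stalk P b -> a * b <> 1.
Proof. by case=> _ na Pb ab; apply: na; exists b. Qed.

Lemma maximal_idealM P a b :
  maximal_ideal P a -> stalk P b -> maximal_ideal P (b * a).
Proof.
move=> ma Pb; split; first by apply: stalkM => //; case: ma.
move=> -[c Pc]; rewrite mulrAC mulrC => abc.
by apply: (maximal_ideal_unit ma) abc; apply: stalkM.
Qed.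

Lemma stalkV P a : stalk P a -> ~ maximal_ideal P a -> a != 0 /\ stalk P a^-1.
Proof.
move=> Pa ma; have a0 : a != 0.
  by apply: contra_notN ma => /eqP->; apply: maximal_ideal0.
split=> //; apply: contrapT => na.
by apply: ma; apply/maximal_idealE.
Qed.

Lemma maximal_idealP P a : ~ stalk P a -> maximal_ideal P a^-1.
Proof.
move=> na; apply/maximal_idealE; rewrite invrK; split=> //.
by case: (stalk_val P a).
Qed.

(** For nonzero [a] and [b] one of [a / b], [b / a] lies in the valuation ring, so [a + b] is a
    multiple of [b] or of [a] in it. *)
Lemma maximal_idealD P a b :
  maximal_ideal P a -> maximal_ideal P b -> maximal_ideal P (a + b).
Proof.
move=> ma mb; split; first by apply: stalkD; apply: maximal_ideal_stalk.
move=> -[c Pc abc].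
have [a0|/eqP a0] := pselect (a = 0).
  by apply: (maximal_ideal_unit mb Pc); rewrite -[RHS]abc a0 add0r.
have [b0|/eqP b0] := pselect (b = 0).
  by apply: (maximal_ideal_unit ma Pc); rewrite -[RHS]abc b0 addr0.
have := stalk_val P (a / b); rewrite invf_div => -[] Pab.
  apply: (maximal_ideal_unit mb (b := (a / b + 1) * c)).
    by apply: stalkM => //; apply: stalkD => //; apply: stalk1.
  by rewrite -[RHS]abc; field.
apply: (maximal_ideal_unit ma (b := (b / a + 1) * c)).
  by apply: stalkM => //; apply: stalkD => //; apply: stalk1.
by rewrite -[RHS]abc; field.
Qed.

Lemma maximal_idealN P a : maximal_ideal P a -> maximal_ideal P (- a).
Proof.
move=> ma; rewrite -mulN1r; apply: maximal_idealM => //.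
by apply: stalkN; apply: stalk1.
Qed.

Lemma maximal_idealB P a b :
  maximal_ideal P a -> maximal_ideal P b -> maximal_ideal P (a - b).
Proof. by move=> ma mb; apply: maximal_idealD => //; apply: maximal_idealN. Qed.

Lemma maximal_ideal_prime P a b : stalk P a -> stalk P b ->
  maximal_ideal P (a * b) -> maximal_ideal P a \/ maximal_ideal P b.
Proof.
move=> Pa Pb mab; have [|na] := pselect (maximal_ideal P a); first by left.
right; have [a0 Pa'] := stalkV Pa na.
by rewrite -(mulKf a0 b); apply: maximal_idealM.
Qed.

(** Nonzero constants are units at every point. This turns congruences modulo a maximal ideal into
    equalities in [k]. *)
Lemma maximal_ideal_cst P c : maximal_ideal P (cst K c) -> c = 0.
Proof.
move=> mc; apply: contrapT => /eqP c0.
apply: (maximal_ideal_unit mc (stalk_cst P c^-1)).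
by rewrite -rmorphM divff// rmorph1.
Qed.

(** Valuation rings are integrally closed: if [z^-1] is in the ring, then so is
    [z = a + b * z^-1]. *)
Lemma stalk_integral P a b z :
  stalk P a -> stalk P b -> z ^+ 2 = a * z + b -> stalk P z.
Proof.
move=> Pa Pb zE; have [->|/eqP z0] := pselect (z = 0); first exact: stalk0.
have [//|Pz] := stalk_val P z.
have -> : z = a + b * z^-1.
  by apply: (mulIf z0); rewrite mulrDl mulfVK// -zE expr2.
by apply: stalkD => //; apply: stalkM.
Qed.

End Valuation.

(** * Extension of a subring to a valuation ring *)

Section Chevalley.
Variable F : fieldType.

Record subring (V : F -> Prop) : Prop := Subring {
  subring1 : V 1;
  subringB : forall a b, V a -> V b -> V (a - b);
  subringM : forall a b, V a -> V b -> V (a * b)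
}.

Section Closure.
Variables (V : F -> Prop) (VV : subring V).

Lemma subring0 : V 0.
Proof. by rewrite -(subrr 1); apply: subringB => //; apply: subring1. Qed.
Lemma subringN a : V a -> V (- a).
Proof. by move=> Va; rewrite -sub0r; apply: subringB => //; apply: subring0.
  Qed.
Lemma subringD a b : V a -> V b -> V (a + b).
Proof.
by move=> Va Vb; rewrite -[b]opprK; apply: subringB => //; apply: subringN.
Qed.
Lemma subring_sum (I : Type) (r : seq I) (Q : pred I) (E : I -> F) :
  (forall i, Q i -> V (E i)) -> V (\sum_(i <- r | Q i) E i).
Proof.
by move=> EV; elim/big_ind: _ => //; [apply: subring0 | apply: subringD].
Qed.
End Closure.

Variables (p q : F).

(** Two generators suffice, because the ideal will be that of a point [(a, b)] of a plane model. *)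
Definition ideal2 (V : F -> Prop) (z : F) : Prop :=
  exists v w, [/\ V v, V w & z = p * v + q * w].

Section Ideal.
Variables (V : F -> Prop) (VV : subring V) (Vp : V p) (Vq : V q).
Local Notation J := (ideal2 V).

Lemma ideal2_sub z : J z -> V z.
Proof.
by move=> [v [w [Vv Vw ->]]]; apply: subringD => //; apply: subringM.
Qed.
Lemma ideal2D a b : J a -> J b -> J (a + b).
Proof.
move=> [v [w [Vv Vw ->]]] [v' [w' [Vv' Vw' ->]]].
exists (v + v'), (w + w'); split; [exact: subringD|exact: subringD|ring].
Qed.
Lemma ideal2M a b : V a -> J b -> J (a * b).
Proof.
move=> Va [v [w [Vv Vw ->]]].
exists (a * v), (a * w); split; [exact: subringM|exact: subringM|ring].
Qed.
Lemma ideal20 : J 0.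
Proof. by exists 0, 0; split; rewrite ?mulr0 ?addr0//; apply: subring0. Qed.

Definition coefs_in (C : F -> Prop) (R : {poly F}) := forall i, C R`_i.

Lemma ideal2_coefsD (R S : {poly F}) :
  coefs_in J R -> coefs_in J S -> coefs_in J (R + S).
Proof. by move=> JR JS i; rewrite coefD; apply: ideal2D. Qed.
Lemma ideal2_coefsZ c (R : {poly F}) :
  V c -> coefs_in J R -> coefs_in J (c *: R).
Proof. by move=> Vc JR i; rewrite coefZ; apply: ideal2M. Qed.
Lemma ideal2_coefsXn c n : J c -> coefs_in J (c *: 'X^n).
Proof.
move=> Jc i; rewrite coefZ coefXn; case: eqP => _; rewrite ?mulr1//.
by rewrite mulr0; apply: ideal20.
Qed.

(* The relation of larger degree can be shortened by means of the other one. *)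
Lemma no_two_relations (R S : {poly F}) (z : F) :
  ~ J 1 -> z != 0 -> coefs_in J R -> coefs_in J S ->
  R.[z] = 1 -> S.[z^-1] = 1 -> False.
Proof.
move=> J1; have [n] := ubnP (size R + size S).
elim: n R S z => [|n IH] R S z; first by rewrite ltn0.
move=> Rn z0 JR JS Rz Sz.
(* Exchanging [z] with [z^-1] exchanges [R] and [S]. *)
wlog le_SR : R S z Rn z0 JR JS Rz Sz / (size S <= size R)%N.
  move=> H; have /orP[le_SR|le_RS] := leq_total (size S) (size R).
    exact: (H R S z).
  apply: (H S R z^-1); rewrite ?invr_eq0 ?invrK//; lia.
have [R1|R1] := leqP (size R) 1.
  apply: J1; move: Rz; rewrite (size1_polyC R1) hornerC => <-; exact: JR.
set m := (size R).-1; have sR : size R = m.+1 by rewrite /m; lia.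
(* Multiplying [S.[z^-1] = 1] by [z^m] gives [T.[z] = z^m (1 - S_0)]. In [R'] the relation [R] is
   scaled by [1 - S_0], so that [T], of degree below [m], can replace its leading power; the term
   [S_0] restores the value 1. *)
pose T : {poly F} := \sum_(1 <= j < m.+1) S`_j *: 'X^(m - j).
pose R' := (S`_0%N)%:P + (1 - S`_0%N) *: (R - R`_m *: 'X^m) + R`_m *: T.
have Tz : T.[z] = z ^+ m * (1 - S`_0%N).
  have -> : 1 - S`_0%N = \sum_(1 <= j < m.+1) S`_j * z^-1 ^+ j.
    rewrite -Sz (@horner_coef_wide _ m.+1); last by rewrite -sR.
    rewrite -(big_mkord xpredT (fun j => S`_j * z^-1 ^+ j)) big_ltn//.
    by rewrite expr0 mulr1 addrAC subrr add0r.
  rewrite /T horner_sum mulr_sumr !big_nat; apply: eq_bigr => j /andP[j1 jm].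
  rewrite hornerZ hornerXn mulrCA; congr (_ * _).
  by rewrite exprVn -expfB_cond// (negPf z0)/=; lia.
have Vb : V (1 - S`_0%N).
  apply: subringB => //; first exact: subring1.
  by apply: ideal2_sub; apply: JS.
apply: (IH R' S z) => //.
- suff : (size R' <= m)%N by lia.
  have m0 : (0 < m)%N by lia.
  apply/leq_sizeP => j mj; rewrite !coefD !coefZ coefB coefC coefZ coefXn.
  rewrite (_ : (j == 0)%N = false); last by lia.
  have -> : T`_j = 0.
    rewrite /T coef_sum big_nat big1// => i /andP[i1 im].
    by rewrite coefZ coefXn (_ : (j == _) = false) ?mulr0//; lia.
  have [->|/eqP jm] := j =P m; first by rewrite mulr1 subrr !mulr0 !addr0.
  by rewrite (leq_sizeP _ m.+1 _ j) ?sR ?mulr0 ?subr0 ?mulr0 ?addr0//; lia.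
- have JT : coefs_in J T.
    rewrite /T; elim/big_ind: _ => [i|R1' S1|i _]; last exact: ideal2_coefsXn.
      by rewrite coef0; apply: ideal20.
    exact: ideal2_coefsD.
  have -> : R' = S`_0%N *: 'X^0 + (1 - S`_0%N) *: (R + (- 1) *: (R`_m *: 'X^m))
                 + R`_m *: T by rewrite scaleN1r expr0 alg_polyC.
  apply: ideal2_coefsD; last first.
    by apply: ideal2_coefsZ => //; apply: ideal2_sub.
  apply: ideal2_coefsD; first exact: ideal2_coefsXn.
  apply: ideal2_coefsZ => //; apply: ideal2_coefsD => //.
  apply: ideal2_coefsZ; last exact: ideal2_coefsXn.
  by apply: subringN => //; apply: subring1.
- rewrite /R' !hornerE Tz Rz; ring.
Qed.

Definition adjoin (z w : F) : Prop :=
  exists2 R : {poly F}, coefs_in V R & w = R.[z].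

Lemma adjoin_subring z : subring (adjoin z).
Proof.
split.
- exists 1; last by rewrite hornerC.
  move=> i; rewrite coefC; case: eqP => _; [exact: subring1|exact: subring0].
- move=> _ _ [R VR ->] [S VS ->]; exists (R - S); last by rewrite !hornerE.
  by move=> i; rewrite coefB; apply: subringB.
- move=> _ _ [R VR ->] [S VS ->]; exists (R * S); last by rewrite hornerM.
  move=> i; rewrite coefM; apply: subring_sum => // j _.
  exact: subringM.
Qed.

Lemma adjoin_sub z w : V w -> adjoin z w.
Proof.
move=> Vw; exists w%:P; last by rewrite hornerC.
by move=> i; rewrite coefC; case: eqP => // _; apply: subring0.
Qed.

Lemma adjoin_mem z : adjoin z z.
Proof.
exists 'X; last by rewrite hornerX.
by move=> i; rewrite coefX; case: eqP => _; [exact: subring1|exact: subring0].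
Qed.

Lemma adjoin_ideal2 z :
  ideal2 (adjoin z) 1 -> exists2 R : {poly F}, coefs_in J R & R.[z] = 1.
Proof.
move=> [_ [_ [[R VR ->] [S VS ->] E]]]; exists (p *: R + q *: S).
  by move=> i; rewrite coefD !coefZ; exists R`_i, S`_i.
by rewrite !hornerE -E.
Qed.

End Ideal.

(* Chevalley's extension theorem for an ideal with two generators. *)
Lemma exists_valuation_ring (A : F -> Prop) :
  subring A -> A p -> A q -> ~ ideal2 A 1 ->
  exists V : F -> Prop, [/\ subring V, forall a, A a -> V a,
    forall z, V z \/ V z^-1 & ~ ideal2 V 1].
Proof.
move=> AA Ap Aq A1.
pose good (V : set F) :=
  [/\ subring V, forall a, A a -> V a & ~ ideal2 V 1].
(* Zorn's lemma also has to cover the empty chain, whose union is empty; hence the alternative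
   [V = set0]. *)
have [|V [[V0|gV] maxV]] := @Zorn_bigcup F (fun V => V = set0 \/ good V).
- move=> C gC totC.
  have [[X CX [x Xx]]|nC] := pselect (exists2 X, C X & exists x, X x);
    last first.
    left; rewrite -subset0 => x [X CX Xx]; apply: nC.
    by exists X => //; exists x.
  have good_mem Y y : C Y -> Y y -> good Y.
    by move=> CY Yy; case: (gC _ CY) => // Y0; rewrite Y0 in Yy.
  have common a b : (\bigcup_(Y in C) Y)%classic a ->
      (\bigcup_(Y in C) Y)%classic b -> exists Y, [/\ C Y, good Y, Y a & Y b].
    move=> [Y CY Ya] [Z CZ Zb]; have [YZ|ZY] := totC Y Z CY CZ.
      by exists Z; split=> //; [apply: good_mem Zb | apply: YZ].
    by exists Y; split=> //; [apply: good_mem Ya | apply: ZY].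
  right; split; first split.
  + by exists X => //; have [XX _ _] := good_mem _ _ CX Xx; apply: subring1.
  + move=> a b /common H /H[Y [CY [YY _ _] Ya Yb]].
    by exists Y => //; apply: subringB.
  + move=> a b /common H /H[Y [CY [YY _ _] Ya Yb]].
    by exists Y => //; apply: subringM.
  + by move=> a Aa; exists X => //; have [_ + _] := good_mem _ _ CX Xx; apply.
  + move=> [v [w [/common H /H[Y [CY [_ _ nY] Yv Yw]] E]]].
    by apply: nY; exists v, w.
- exfalso; apply: (maxV A); last by right; split.
  by rewrite V0; split=> // /(_ 1 (subring1 AA)).
- case: gV => VV AV V1; exists V; split=> // z.
  apply: contrapT => /not_orP[Vz Vz'].
  have z0 : z != 0.
    by apply: contra_notN Vz => /eqP->; apply: subring0.
  (* By maximality of [V] the ideal becomes improper in [V[u]]; this applies to [z] and to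
     [z^-1]. *)
  have rel u : ~ V u -> exists2 R : {poly F}, coefs_in (ideal2 V) R & R.[u] = 1.
    move=> Vu; apply: adjoin_ideal2; apply: contrapT => nJ.
    apply: (maxV (adjoin V u)); last first.
      right; split=> //; first exact: adjoin_subring.
      by move=> a Aa; apply: adjoin_sub => //; apply: AV.
    split; first by move=> a; apply: adjoin_sub.
    by move=> /(_ u (adjoin_mem VV u)).
  have [R JR Rz] := rel _ Vz; have [S JS Sz] := rel _ Vz'.
  exact: (no_two_relations VV (AV _ Ap) (AV _ Aq) V1 z0 JR JS Rz Sz).
Qed.

End Chevalley.

(** * Points of the curve from proper ideals *)

Section Points.
Variables (k : closedFieldType) (K : fieldExtType {fraction {poly k}}).

Lemma exists_point (A : K -> Prop) (p q : K) :
  subring A -> (forall c, A (cst K c)) -> A p -> A q -> p != 0 ->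
  ~ ideal2 p q A 1 ->
  exists P : point K, [/\ forall a, A a -> stalk P a,
    maximal_ideal P p & maximal_ideal P q].
Proof.
move=> AA Ac Ap Aq p0 nA.
have [V [VV AV valV nV]] := exists_valuation_ring AA Ap Aq nA.
(* The ring is not all of [K]: together with [p^-1] it would have [p * p^-1 = 1] in the ideal. *)
have Vp' : exists a, ~ V a.
  exists p^-1 => Vp'; apply: nV; exists p^-1, 0; split=> //.
    exact: subring0.
  by rewrite divff// mulr0 addr0.
pose P := @Point k K V (fun c => AV _ (Ac c)) (subringB VV) (subringM VV)
  valV Vp'.
have V0 := subring0 VV; have Vp := AV _ Ap; have Vq := AV _ Aq.
exists P; split=> //; split=> // -[b Vb E]; apply: nV.
  by exists b, 0; split; rewrite ?mulr0 ?addr0.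
by exists 0, b; split; rewrite ?mulr0 ?add0r.
Qed.

End Points.

(** * Smooth plane models *)

(** Over an algebraically closed field a polynomial splits, so denominators can be cleared one
    linear factor at a time. *)
Lemma closed_poly_ind (k : closedFieldType) (Q : {poly k} -> Prop) :
  (forall c, c != 0 -> Q c%:P) ->
  (forall r p, p != 0 -> Q p -> Q (p * ('X - r%:P))) ->
  forall p, p != 0 -> Q p.
Proof.
move=> QC QM p; have [n] := ubnP (size p); elim: n p => [|n IH] p.
  by rewrite ltn0.
move=> pn p0; have [/eqP p1|p1] := boolP (size p == 1%N).
  have pE := size1_polyC (eq_leq p1).
  by rewrite pE; apply: QC; rewrite -polyC_eq0 -pE.
have /closed_rootP[r /factor_theorem[q pE]] := p1.
have q0 : q != 0 by apply: contra_neq p0 => q0; rewrite pE q0 mul0r.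
rewrite pE; apply: QM => //; apply: IH => //.
by move: pn; rewrite pE size_Mmonic ?monicXsubC// size_XsubC addnC.
Qed.

Lemma poly_split (R : comNzRingType) (p : {poly R}) (a : R) :
  exists q, p = ('X - a%:P) * q + p.[a]%:P.
Proof.
have /factor_theorem[q pE] : root (p - p.[a]%:P) a.
  by rewrite /root !hornerE subrr.
by exists q; rewrite mulrC -pE subrK.
Qed.

Section Chart.
Variables (k : closedFieldType) (K : fieldExtType {fraction {poly k}}).
Implicit Types (P : point K) (X Y z : K) (p q u v h f : {poly k}).

(** Evaluation at an arbitrary [X] in [K], so that one theory serves both [x] and [1/x]. *)
Definition pev X : {poly k} -> K := horner_eval X \o map_poly (cst K).
HB.instance Definition _ X := GRing.RMorphism.on (pev X).

Lemma pevE X p : pev X p = \sum_(i < size p) cst K p`_i * X ^+ i.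
Proof. by rewrite /pev /= horner_evalE horner_poly. Qed.

Lemma pevC X c : pev X c%:P = cst K c.
Proof. by rewrite /pev /= horner_evalE map_polyC hornerC. Qed.

Lemma pevX X : pev X 'X = X.
Proof. by rewrite /pev /= horner_evalE map_polyX hornerX. Qed.

Lemma pevZ X c p : pev X (c *: p) = cst K c * pev X p.
Proof. by rewrite -mul_polyC rmorphM /= pevC. Qed.

Lemma stalk_pev P X p : stalk P X -> stalk P (pev X p).
Proof.
move=> PX; rewrite pevE; apply: stalk_sum => i _.
by apply: stalkM; [apply: stalk_cst | apply: stalkX].
Qed.

Lemma pev_mod P X a p :
  maximal_ideal P (X - cst K a) -> maximal_ideal P (pev X p - cst K p.[a]).
Proof.
move=> mX; have [q pE] := poly_split p a.
rewrite {1}pE rmorphD rmorphM rmorphB /= pevC pevX pevC addrK mulrC.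
apply: maximal_idealM => //; apply: stalk_pev.
rewrite -[X](subrK (cst K a)); apply: stalkD; last exact: stalk_cst.
exact: maximal_ideal_stalk.
Qed.

Lemma derivation_pev (D : K -> K^o) X p :
  is_derivation D -> D (pev X p) = pev X p^`() * D X.
Proof.
move=> [DD DM Dc]; elim/poly_ind: p => [|p c IH].
  by rewrite deriv0 !rmorph0 /= -(rmorph0 (cst K)) Dc rmorph0 /= mul0r.
rewrite !rmorphD !rmorphM /= pevC pevX DD DM IH Dc addr0.
rewrite derivD derivM derivX derivC addr0 mulr1 rmorphD rmorphM /= pevX.
by rewrite /GRing.scale /=; ring.
Qed.

(* [Y^2 = h(X) Y + f(X)] is an affine plane model of the curve, with
   [K = k(X) + k(X) Y], and [D] is the derivation dual to the differential
   [dX / (2 Y - h(X))]. *)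
Record chart X Y h f (D : K -> K^o) : Prop := Chart {
  chart_eq : Y ^+ 2 = pev X h * Y + pev X f;
  chart_span : forall z, exists u v c,
    c != 0 /\ z * pev X c = pev X u + pev X v * Y;
  chart_free : forall u v, pev X u + pev X v * Y = 0 -> u = 0 /\ v = 0;
  chart_der : is_derivation D;
  chart_DX : D X = 2%:R * Y - pev X h;
  chart_DY : D Y = pev X h^`() * Y + pev X f^`()
}.

(** The Jacobian criterion for [Y^2 - h(X) Y - f(X)] at the points [(a, b)] over [X = a]. *)
Definition smooth_at h f (a : k) : Prop := forall b, 
  b ^+ 2 = h.[a] * b + f.[a] ->
  ~ (2%:R * b = h.[a] /\ h^`().[a] * b + f^`().[a] = 0).

Definition affine_ring X Y z : Prop :=
  exists u v, z = pev X u + pev X v * Y.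

Section Theory.
Variables (X Y : K) (h f : {poly k}) (D : K -> K^o).
Hypothesis XY : chart X Y h f D.
Local Notation A := (affine_ring X Y).

Lemma affine_ring_subring : subring A.
Proof.
split.
- by exists 1, 0; rewrite rmorph1 rmorph0 /= mul0r addr0.
- move=> _ _ [u [v ->]] [u' [v' ->]]; exists (u - u'), (v - v').
  by rewrite !rmorphB /=; ring.
- move=> _ _ [u [v ->]] [u' [v' ->]].
  exists (u * u' + v * v' * f), (u * v' + v * u' + v * v' * h).
  rewrite !rmorphD !rmorphM /=.
  transitivity (pev X u * pev X u' + pev X v * pev X v' * Y ^+ 2 +
    (pev X u * pev X v' + pev X v * pev X u') * Y); first by ring.
  by rewrite (chart_eq XY); ring.
Qed.

Lemma affine_ring_pev u : A (pev X u).
Proof. by exists u, 0; rewrite rmorph0 /= mul0r addr0. Qed.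
Lemma affine_ring_Y : A Y.
Proof. by exists 0, 1; rewrite rmorph0 rmorph1 /= mul1r add0r. Qed.

Lemma stalk_Y P : stalk P X -> stalk P Y.
Proof.
by move=> PX; apply: stalk_integral (chart_eq XY); apply: stalk_pev.
Qed.

Lemma stalk_affine_ring P z : stalk P X -> A z -> stalk P z.
Proof.
move=> PX [u [v ->]]; apply: stalkD; first exact: stalk_pev.
by apply: stalkM; [apply: stalk_pev | apply: stalk_Y].
Qed.

Lemma chart_pev_eq0 p : pev X p = 0 -> p = 0.
Proof.
by move=> p0; case: (chart_free XY (u := p) (v := 0));
  rewrite ?p0 ?rmorph0 /= ?mul0r ?addr0.
Qed.

Lemma chart_XsubC_neq0 a : X - cst K a != 0.
Proof.
apply/eqP => Xa; have := @chart_pev_eq0 ('X - a%:P).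
by rewrite rmorphB /= pevX pevC Xa => /(_ erefl)/eqP; rewrite polyXsubC_eq0.
Qed.

Lemma stalk_X P a : maximal_ideal P (X - cst K a) -> stalk P X.
Proof.
move=> mX; rewrite -[X](subrK (cst K a)); apply: stalkD; last exact: stalk_cst.
exact: maximal_ideal_stalk.
Qed.

(** Otherwise every [X - r] is a unit at [P], hence every denominator is, and the valuation ring
    would be all of [K]. *)
Lemma exists_residue P : stalk P X ->
  exists a, maximal_ideal P (X - cst K a).
Proof.
move=> PX; apply: contrapT => na.
have [z] := stalk_proper P; apply.
have [u [v [c [c0 zE]]]] := chart_span XY z.
have pc0 : pev X c != 0 by apply: contra_neq c0 => /chart_pev_eq0.
have Pc : stalk P (pev X c)^-1.
  move: c c0 {zE pc0}; apply: closed_poly_ind => [c c0|r p p0 IH].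
    by rewrite pevC -fmorphV; apply: stalk_cst.
  rewrite rmorphM /= invfM rmorphB /= pevX pevC; apply: stalkM => //.
  have [||_ //] := @stalkV _ _ P (X - cst K r).
    by apply: stalkB => //; apply: stalk_cst.
  by move=> mr; apply: na; exists r.
rewrite -(mulfK pc0 z) zE; apply: stalkM => //.
by apply: stalk_affine_ring => //; exists u, v.
Qed.

Lemma exists_fiber_root a : exists b, b ^+ 2 = h.[a] * b + f.[a].
Proof.
have [b bE] := @solve_monicpoly k 2 (nth 0 [:: f.[a]; h.[a]]) isT.
by exists b; rewrite bE !big_ord_recl big_ord0 /= expr0 expr1 mulr1 addr0 addrC.
Qed.

(** The roots of the fibre equation are [b] and [h(a) - b]; the product of the two factors
    [Y - root] lies in the maximal ideal, which is prime. *)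
Lemma exists_Y_residue P a : maximal_ideal P (X - cst K a) ->
  exists b, b ^+ 2 = h.[a] * b + f.[a] /\ maximal_ideal P (Y - cst K b).
Proof.
move=> mX; have [b bE] := exists_fiber_root a; have PX := stalk_X mX.
have : maximal_ideal P ((Y - cst K b) * (Y - cst K (h.[a] - b))).
  have -> : (Y - cst K b) * (Y - cst K (h.[a] - b)) =
      Y * (pev X h - cst K h.[a]) + (pev X f - cst K f.[a]).
    transitivity (Y ^+ 2 - cst K h.[a] * Y + cst K b * cst K h.[a]
      - cst K (b ^+ 2)); first by rewrite !rmorphB rmorphXn /=; ring.
    by rewrite (chart_eq XY) bE !rmorphD !rmorphM /=; ring.
  apply: maximal_idealD; last exact: pev_mod.
  by apply: maximal_idealM; [exact: pev_mod | exact: stalk_Y].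
have PY c : stalk P (Y - cst K c).
  by apply: stalkB; [exact: stalk_Y | exact: stalk_cst].
case/(maximal_ideal_prime (PY _) (PY _)) => mY; first by exists b.
exists (h.[a] - b); split=> //.
transitivity (h.[a] ^+ 2 - 2%:R * h.[a] * b + b ^+ 2); first by ring.
by rewrite bE; ring.
Qed.

Lemma fiber_factor a b : b ^+ 2 = h.[a] * b + f.[a] ->
  exists2 q, (Y - cst K b) * (Y - pev X h + cst K b) = (X - cst K a) * pev X q
    & q.[a] = h^`().[a] * b + f^`().[a].
Proof.
(* By the equation of the curve, the product [(Y - b) (Y - h + b)] equals [N(X)]; the value [q(a)]
   is then [N'(a)]. *)
move=> bE; pose N := f + b *: h - (b ^+ 2)%:P.
have Na : N.[a] = 0 by rewrite /N !hornerE bE; ring.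
have [q NE] := poly_split N a; rewrite Na addr0 in NE.
exists q.
  transitivity (Y ^+ 2 - pev X h * Y + cst K b * pev X h - cst K (b ^+ 2)).
    by rewrite rmorphXn /=; ring.
  transitivity (pev X N).
    by rewrite (chart_eq XY) /N rmorphB rmorphD /= pevC pevZ; ring.
  by rewrite NE rmorphM rmorphB /= pevC pevX.
have := congr1 (fun p => p^`().[a]) NE.
rewrite /N !derivE !hornerE => E.
by rewrite addrC [_ * b]mulrC -[RHS]subr0 E; ring.
Qed.

Lemma affine_ring_split a z : A z ->
  exists z' c d, A z' /\ z = (X - cst K a) * z' + cst K c + cst K d * Y.
Proof.
move=> [u [v ->]]; have [u' uE] := poly_split u a.
have [v' vE] := poly_split v a.
exists (pev X u' + pev X v' * Y), u.[a], v.[a]; split; first by exists u', v'.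
rewrite {1}uE {1}vE !rmorphD !rmorphM rmorphB /= !pevC pevX; ring.
Qed.

(** Only the remainder [c + d Y] matters, and it must vanish at [(a, b)]. If [2 b = h(a)] and [d]
    were nonzero, [(Y - b) / (X - a)] would be regular at [P]; since [Y - h + b] vanishes there, so
    would [q(a)] of [fiber_factor], against smoothness. *)
Lemma stalk_split P a b c d z' :
  maximal_ideal P (X - cst K a) -> maximal_ideal P (Y - cst K b) ->
  b ^+ 2 = h.[a] * b + f.[a] -> smooth_at h f a -> A z' ->
  stalk P (((X - cst K a) * z' + cst K c + cst K d * Y) / (X - cst K a)) ->
  c + d * b = 0 /\ (2%:R * b = h.[a] -> d = 0).
Proof.
move=> mX mY bE sm Az' Pz; have PX := stalk_X mX.
have Pz' := stalk_affine_ring PX Az'; have Xa := chart_XsubC_neq0 a.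
set w := (cst K c + cst K d * Y) / (X - cst K a).
have Pw : stalk P w.
  have -> : w = ((X - cst K a) * z' + cst K c + cst K d * Y) / (X - cst K a) -
    z'.
    by rewrite /w; field.
  exact: stalkB.
have cd : c + d * b = 0.
  apply: (@maximal_ideal_cst _ _ P).
  have -> : cst K (c + d * b) = w * (X - cst K a) - cst K d * (Y - cst K b).
    by rewrite /w rmorphD rmorphM /=; field.
  apply: maximal_idealB; apply: maximal_idealM => //; exact: stalk_cst.
split=> // hb; apply: contrapT => /eqP d0.
have [q qE qa] := fiber_factor bE.
apply: (sm b bE); split=> //; rewrite -qa.
apply: (@maximal_ideal_cst _ _ P).
have -> : cst K q.[a] = cst K d^-1 * w * (Y - pev X h + cst K b)
    - (pev X q - cst K q.[a]).
  have cE : cst K c = - (cst K d * cst K b).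
    by apply/eqP; rewrite -addr_eq0 -rmorphM -rmorphD cd rmorph0 /=.
  have -> : pev X q = (Y - cst K b) * (Y - pev X h + cst K b) / (X - cst K a).
    by rewrite qE mulrC mulKf.
  have d0' : cst K d != 0 by rewrite fmorph_eq0.
  by rewrite /w cE fmorphV; field; rewrite Xa d0'.
apply: maximal_idealB; last exact: pev_mod.
apply: maximal_idealM; last by apply: stalkM => //; exact: stalk_cst.
have -> : Y - pev X h + cst K b = (Y - cst K b) - (pev X h - cst K h.[a]).
  by rewrite -hb rmorphM rmorph_nat /=; ring.
by apply: maximal_idealB => //; exact: pev_mod.
Qed.

(** This is the localisation statement: each regular element at [P] is a quotient of elements of [A]
    with denominator a unit at [P]. The denominator given by [chart_span] is replaced one linear
    factor at a time. *)
Lemma stalk_numerator P a z :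
  maximal_ideal P (X - cst K a) -> smooth_at h f a -> stalk P z ->
  exists s, [/\ A s, A (z * s), s != 0 & stalk P s^-1].
Proof.
move=> mX sm; have PX := stalk_X mX; have AA := affine_ring_subring.
have [u [v [c [c0 zE]]]] := chart_span XY z.
have : A (z * pev X c) by exists u, v.
move: c c0 z {u v zE}; apply: closed_poly_ind => [c c0|r p p0 IH] z.
  move=> Azc Pz; exists (cst K c); rewrite -(pevC X); split=> //.
  - exact: affine_ring_pev.
  - by rewrite pevC fmorph_eq0.
  - by rewrite pevC -fmorphV; exact: stalk_cst.
rewrite rmorphM rmorphB /= pevX pevC => Azp Pz.
have Pr : stalk P (X - cst K r) by apply: stalkB => //; exact: stalk_cst.
have Ar : A (X - cst K r).
  by rewrite -(pevC X) -[X in A (X - _)](pevX X) -rmorphB;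
    exact: affine_ring_pev.
have [||s [As Azs s0 Ps]] := IH (z * (X - cst K r)).
- by rewrite mulrAC -mulrA.
- by apply: stalkM.
(* A factor that is a unit at [P] joins the denominator [s]; any other factor is [X - a]. *)
have [mr|mr] := pselect (maximal_ideal P (X - cst K r)); last first.
  have [r0 Pr'] := stalkV Pr mr.
  exists ((X - cst K r) * s); split.
  + exact: subringM.
  + by rewrite mulrA.
  + by rewrite mulf_neq0.
  + by rewrite invfM; apply: stalkM.
have -> : z = z * (X - cst K r) / (X - cst K r).
  by rewrite mulfK// chart_XsubC_neq0.
have ra : r = a.
  apply/eqP; rewrite -subr_eq0; apply/eqP; apply: (@maximal_ideal_cst _ _ P).
  rewrite rmorphB /= (_ : _ - _ = (X - cst K a) - (X - cst K r)); last by ring.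
  exact: maximal_idealB.
rewrite {r mr}ra in Ar Azs Pr Azp *.
have Xa := chart_XsubC_neq0 a.
have [z' [c [d [Az' wE]]]] := affine_ring_split a Azs.
have [b [bE mY]] := exists_Y_residue mX.
have Psz : stalk P (z * s).
  by apply: stalkM => //; exact: stalk_affine_ring As.
have [cd hd] : c + d * b = 0 /\ (2%:R * b = h.[a] -> d = 0).
  apply: (stalk_split (P := P) (z' := z')) => //; rewrite -wE.
  by rewrite mulrAC mulfK.
have cE : cst K c = - (cst K d * cst K b).
  by apply/eqP; rewrite -addr_eq0 -rmorphM -rmorphD cd rmorph0 /=.
have [q qE _] := fiber_factor bE.
(* At a ramified point the remainder vanishes, so [X - a] divides [z * s] times [X - a] within
   [A]. *)
have [hb|hb] := pselect (2%:R * b = h.[a]).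
  exists s; split=> //; rewrite mulfK//.
  suff -> : z * s = z' by [].
  apply: (mulfI Xa); rewrite mulrCA mulrA mulrC.
  by rewrite mulrC wE cE (hd hb) rmorph0 /= !mul0r oppr0 !addr0.
(* At an unramified point [t] is a unit, and it turns [(Y - b) / (X - a)] into the polynomial
   [q(X)]. *)
pose t := Y - pev X h + cst K b.
have At : A t.
  apply: subringD => //; last by rewrite -(pevC X); exact: affine_ring_pev.
  by apply: subringB => //; [exact: affine_ring_Y | exact: affine_ring_pev].
have [t0 Pt] : t != 0 /\ stalk P t^-1.
  apply: stalkV; first exact: stalk_affine_ring At.
  move=> mt; apply: hb; apply/eqP; rewrite -subr_eq0; apply/eqP.
  apply: (@maximal_ideal_cst _ _ P).
  have -> : cst K (2%:R * b - h.[a]) =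
      t - ((Y - cst K b) - (pev X h - cst K h.[a])).
    by rewrite /t rmorphB rmorphM rmorph_nat /=; ring.
  apply: maximal_idealB => //; apply: maximal_idealB => //; exact: pev_mod.
exists (s * t); split.
- exact: subringM.
- rewrite mulfK//; have -> : z * (s * t) = z' * t + cst K d * pev X q.
    apply: (mulfI Xa).
    transitivity ((X - cst K a) * z' * t + cst K d * ((X - cst K a) * pev X q));
      last by ring.
    rewrite -qE.
    transitivity (z * (X - cst K a) * s * t); first by ring.
    by rewrite wE cE /t; ring.
  apply: subringD => //; first exact: subringM.
  by rewrite -pevZ; exact: affine_ring_pev.
- by rewrite mulf_neq0.
- by rewrite invfM; apply: stalkM.
Qed.

(** * The derivation on the coordinate ring and on local rings *)

Lemma derivation_affine_ring z : A z -> A (D z).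
Proof.
have AA := affine_ring_subring; have [DD DM _] := chart_der XY.
move=> [u [v ->]]; rewrite DD DM !(derivation_pev _ _ (chart_der XY)).
have ADX : A (D X).
  rewrite (chart_DX XY); apply: subringB => //; last exact: affine_ring_pev.
  apply: subringM => //; last exact: affine_ring_Y.
  by rewrite -(rmorph_nat (pev X)); exact: affine_ring_pev.
have ADY : A (D Y).
  rewrite (chart_DY XY); apply: subringD => //; last exact: affine_ring_pev.
  by apply: subringM => //; [exact: affine_ring_pev | exact: affine_ring_Y].
have AY := affine_ring_Y; have Ap := affine_ring_pev.
by do !(apply: subringD || apply: subringM).
Qed.

(** The quotient rule reduces the claim to [A], because the denominator is a unit at [P]. *)
Lemma derivation_stalk P a z :
  maximal_ideal P (X - cst K a) -> smooth_at h f a -> stalk P z ->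
  stalk P (D z).
Proof.
move=> mX sm Pz; have PX := stalk_X mX.
have [s [As Azs s0 Ps]] := stalk_numerator mX sm Pz.
have [_ DM _] := chart_der XY.
have -> : D z = (D (z * s) - z * D s) / s.
  by rewrite DM /GRing.scale /=; field.
have PA w : A w -> stalk P w by apply: stalk_affine_ring.
apply: stalkM => //; apply: stalkB; last apply: stalkM => //;
  by apply: PA; apply: derivation_affine_ring.
Qed.

(** Modulo the maximal ideal, [D X] and [D Y] are [2 b - h(a)] and [h'(a) b + f'(a)]; smoothness
    says that one of them is a unit. *)
Lemma derivation_stalk_unit P a :
  maximal_ideal P (X - cst K a) -> smooth_at h f a ->
  exists e z, [/\ stalk P e, stalk P z & e * D z = 1].
Proof.
move=> mX sm; have PX := stalk_X mX.
have [b [bE mY]] := exists_Y_residue mX.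
have AA := affine_ring_subring.
have PD w : A w -> stalk P (D w).
  by move=> Aw; apply: stalk_affine_ring => //; apply: derivation_affine_ring.
have AX : A X by rewrite -[X in A X](pevX X); exact: affine_ring_pev.
have AY := affine_ring_Y.
have [mDX|mDX] := pselect (maximal_ideal P (D X)); last first.
  have [DX0 PDX] := stalkV (PD _ AX) mDX.
  by exists (D X)^-1, X; split=> //; rewrite mulVf.
have [mDY|mDY] := pselect (maximal_ideal P (D Y)); last first.
  have [DY0 PDY] := stalkV (PD _ AY) mDY.
  by exists (D Y)^-1, Y; split=> //; [exact: stalk_Y|rewrite mulVf].
exfalso; apply: (sm b bE); split.
  apply/eqP; rewrite -subr_eq0; apply/eqP; apply: (@maximal_ideal_cst _ _ P).
  have -> : cst K (2%:R * b - h.[a]) =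
      D X - 2%:R * (Y - cst K b) + (pev X h - cst K h.[a]).
    by rewrite (chart_DX XY) rmorphB rmorphM rmorph_nat /=; ring.
  apply: maximal_idealD; last exact: pev_mod.
  apply: maximal_idealB => //; apply: maximal_idealM => //.
  by rewrite -(rmorph_nat (cst K)); exact: stalk_cst.
apply: (@maximal_ideal_cst _ _ P).
have -> : cst K (h^`().[a] * b + f^`().[a]) =
    D Y - pev X h^`() * (Y - cst K b)
    - cst K b * (pev X h^`() - cst K h^`().[a])
    - (pev X f^`() - cst K f^`().[a]).
  by rewrite (chart_DY XY) rmorphD rmorphM /=; ring.
apply: maximal_idealB; last exact: pev_mod.
apply: maximal_idealB; last by apply: maximal_idealM;
  [exact: pev_mod|exact: stalk_cst].
apply: maximal_idealB => //; apply: maximal_idealM => //; exact: stalk_pev.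
Qed.

(** * Points over a fibre and removal of denominators *)

Lemma exists_point_over a b : b ^+ 2 = h.[a] * b + f.[a] ->
  exists P, maximal_ideal P (X - cst K a) /\ maximal_ideal P (Y - cst K b).
Proof.
move=> bE; have AA := affine_ring_subring.
have Ac c : A (cst K c) by rewrite -(pevC X); exact: affine_ring_pev.
have AX : A X by rewrite -[X in A X](pevX X); exact: affine_ring_pev.
have AXa : A (X - cst K a) by exact: subringB.
have AYb : A (Y - cst K b) by apply: subringB => //; exact: affine_ring_Y.
suff nJ : ~ ideal2 (X - cst K a) (Y - cst K b) A 1.
  have [P [_ mX mY]] := exists_point AA Ac AXa AYb (chart_XsubC_neq0 a) nJ.
  by exists P.
move=> [_ [_ [[v0 [v1 ->]] [w0 [w1 ->]] E]]].
(* The coefficients of 1 and [Y] in an expression of 1 by [X - a] and [Y - b]. Evaluated at [a] they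
   contradict the fibre equation for [b]. *)
have [|E0 E1] := chart_free XY
    (u := ('X - a%:P) * v0 + w1 * f - b%:P * w0 - 1)
    (v := ('X - a%:P) * v1 + w0 + w1 * h - b%:P * w1).
  rewrite !(rmorphB, rmorphD, rmorphM, rmorph1) /= !pevX !pevC.
  transitivity ((X - cst K a) * (pev X v0 + pev X v1 * Y)
      - 1 + (pev X w1 * (pev X h * Y + pev X f))
      + pev X w0 * Y - cst K b * pev X w0 - cst K b * pev X w1 * Y);
        first by ring.
  by rewrite -(chart_eq XY) {1}E; ring.
have E1' : w0.[a] = b * w1.[a] - w1.[a] * h.[a].
  apply/eqP; rewrite -subr_eq0; apply/eqP.
  by have := congr1 (fun p => p.[a]) E1; rewrite !hornerE => <-; ring.
have E0' : w1.[a] * f.[a] - b * w0.[a] - 1 = 0.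
  by have := congr1 (fun p => p.[a]) E0; rewrite !hornerE => <-; ring.
move/eqP: E0'; rewrite E1'.
have -> : w1.[a] * f.[a] - b * (b * w1.[a] - w1.[a] * h.[a]) - 1 =
    w1.[a] * (h.[a] * b + f.[a] - b ^+ 2) - 1 by ring.
by rewrite bE subrr mulr0 sub0r oppr_eq0 oner_eq0.
Qed.

Lemma affine_ring_div a z : smooth_at h f a -> A z ->
  (forall P, maximal_ideal P (X - cst K a) -> stalk P (z / (X - cst K a))) ->
  A (z / (X - cst K a)).
Proof.
move=> sm Az Pz; have Xa := chart_XsubC_neq0 a.
have [z' [c [d [Az' zE]]]] := affine_ring_split a Az.
suff [c0 d0] : c = 0 /\ d = 0.
  by rewrite zE c0 d0 !rmorph0 /= mul0r !addr0 mulrC mulKf.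
have fib b : b ^+ 2 = h.[a] * b + f.[a] ->
    c + d * b = 0 /\ (2%:R * b = h.[a] -> d = 0).
  move=> bE; have [P [mX mY]] := exists_point_over bE.
  apply: (stalk_split mX mY bE sm Az'); rewrite -zE; exact: Pz.
have [b bE] := exists_fiber_root a.
have [cd hd] := fib _ bE.
have [|cd' _] := fib (h.[a] - b).
  transitivity (h.[a] ^+ 2 - 2%:R * h.[a] * b + b ^+ 2); first by ring.
  by rewrite bE; ring.
(* Vanishing of [c + d Y] at both roots of the fibre forces [d = 0] when they differ; a double root
   is the ramified case of [fib]. *)
have d0 : d = 0.
  have : d * (2%:R * b - h.[a]) = 0.
    by rewrite -[RHS](subrr 0) -{1}cd -cd'; ring.
  move=> /eqP; rewrite mulf_eq0 => /orP[/eqP//|].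
  by rewrite subr_eq0 => /eqP /hd.
by split=> //; rewrite -cd d0 mul0r addr0.
Qed.

(** [affine_ring_div] cancels the linear factors of [c] in turn, so only the fibres over roots of
    [c] have to be smooth and to lie in [U]. *)
Lemma regular_affine_ring (U : point K -> Prop) c z :
  c != 0 ->
  (forall a, root c a -> smooth_at h f a) ->
  (forall a P, root c a -> maximal_ideal P (X - cst K a) -> U P) ->
  functions_on U z -> A (z * pev X c) -> A z.
Proof.
move=> c0; move: c c0; apply: closed_poly_ind => [c c0|r p p0 IH].
  rewrite pevC => _ _ _ Az.
  have c0' : cst K c != 0 by rewrite fmorph_eq0.
  rewrite -(mulfK c0' z); apply: subringM => //;
    first exact: affine_ring_subring.
  by rewrite -fmorphV /= -(pevC X); exact: affine_ring_pev.
move=> sm cU Uz Az; have Xr := chart_XsubC_neq0 r.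
have sub a : root p a -> root (p * ('X - r%:P)) a.
  by rewrite rootM => ->.
have rr : root (p * ('X - r%:P)) r by rewrite rootM root_XsubC eqxx orbT.
apply: IH => //.
- by move=> a /sub; apply: sm.
- by move=> a P /sub; apply: cU.
have -> : z * pev X p = z * pev X (p * ('X - r%:P)) / (X - cst K r).
  by rewrite rmorphM rmorphB /= pevX pevC mulrA mulfK.
apply: affine_ring_div => //; first exact: sm.
move=> P mX; rewrite rmorphM rmorphB /= pevX pevC mulrA mulfK//.
apply: stalkM; first by apply: Uz; apply: cU mX.
by apply: stalk_pev; apply: stalk_X mX.
Qed.

End Theory.
End Chart.

(** * The model at infinity *)

Section Reversal.
Variable R : nzSemiRingType.
Implicit Type p : {poly R}.

(** The reciprocal polynomial [X^n p(1/X)] when [p] has degree at most [n]. The exponent is a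
    parameter because [h] and [f] are reversed in degrees [g + 1] and [2 g + 2], whatever their
    actual degrees. *)
Definition revp (n : nat) p : {poly R} := \poly_(j < n.+1) p`_(n - j).

Lemma coef_revp n p j : (revp n p)`_j = if (j <= n)%N then p`_(n - j) else 0.
Proof. by rewrite coef_poly ltnS. Qed.

Lemma size_revp n p : (size (revp n p) <= n.+1)%N.
Proof. exact: size_poly. Qed.

Lemma revpK n p : (size p <= n.+1)%N -> revp n (revp n p) = p.
Proof.
move=> pn; apply/polyP => j; rewrite !coef_revp leq_subr.
by case: leqP => jn; [rewrite subKn | rewrite nth_default ?(leq_trans pn)].
Qed.

Lemma revp_eq0 n p : (size p <= n.+1)%N -> revp n p = 0 -> p = 0.
Proof.
move=> pn p0; rewrite -(revpK pn) p0; apply/polyP => j.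
by rewrite coef_revp !coef0; case: ifP.
Qed.
End Reversal.

Section InverseChart.
Variables (k : closedFieldType) (K : fieldExtType {fraction {poly k}}).
Variables (x y : K) (h f : {poly k}) (D : K -> K^o) (g : nat).
Hypothesis xy : chart x y h f D.

Lemma pev_wide (X : K) n (p : {poly k}) : (size p <= n)%N ->
  pev X p = \sum_(i < n) cst K p`_i * X ^+ i.
Proof.
move=> pn; rewrite pevE (big_ord_widen n (fun i => cst K p`_i * X ^+ i))//.
rewrite big_mkcond; apply: eq_bigr => i _; case: ltnP => // pi.
by rewrite nth_default// rmorph0 mul0r.
Qed.

Lemma pev_revp (X : K) n (p : {poly k}) : X != 0 -> (size p <= n.+1)%N ->
  pev X^-1 (revp n p) = pev X p / X ^+ n.
Proof.
move=> X0 pn; rewrite (pev_wide _ (size_revp n p)) (pev_wide X pn).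
rewrite mulr_suml (reindex_inj rev_ord_inj); apply: eq_bigr => i _ /=.
have ii : (i <= n)%N by rewrite -ltnS.
rewrite subSS coef_revp leq_subr subKn// -mulrA; congr (_ * _).
by rewrite exprVn expfB_cond ?(negPf X0)//= invf_div.
Qed.

Lemma pev_revpV (X : K) n (p : {poly k}) : X != 0 -> (size p <= n.+1)%N ->
  pev X (revp n p) = pev X^-1 p * X ^+ n.
Proof.
move=> X0 pn; rewrite -{1}[X]invrK pev_revp ?invr_eq0//.
by rewrite exprVn invrK.
Qed.

Lemma chart_x_neq0 : x != 0.
Proof. by have := chart_XsubC_neq0 xy 0; rewrite rmorph0 subr0. Qed.
Let x0 := chart_x_neq0.

Local Notation t := (x^-1).
Local Notation u := (y / x ^+ g.+1).
(* The reciprocal model [u^2 = hinv(t) u + finv(t)] with [t = 1/x] and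
   [u = y / x^(g+1)]; [Dinv] is the dual derivation [- x^(1-g) D], where
   [x / x^g] also covers [g = 0]. *)
Definition hinv := revp g.+1 h.
Definition finv := revp (2 * g).+2 f.
Definition Dinv : K -> K^o := fun z => - (x / x ^+ g) * D z.

(** Stating this for all large [M] leaves room to match the exponent with other powers of [x]. *)
Lemma affine_ring_inverse z : affine_ring x y z ->
  exists M0, forall M, (M0 <= M)%N -> affine_ring t u (z / x ^+ M).
Proof.
move=> [a [b ->]]; exists (size a + size b + g.+1)%N => M le.
exists (revp M a), (revp (M - g.+1) b).
rewrite !pev_revp//; [|lia|lia].
rewrite mulrDl; congr (_ + _).
have -> : x ^+ M = x ^+ (M - g.+1) * x ^+ g.+1.
  by rewrite -exprD subnK//; lia.
by field; rewrite !expf_eq0/= (negPf x0) ?andbF.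
Qed.

Lemma affine_ring_inverseV (a b : {poly k}) M :
  (size a + size b + g.+1 <= M)%N ->
  (pev t a + pev t b * u) * x ^+ M =
  pev x (revp M a) + pev x (revp (M - g.+1) b) * y.
Proof.
move=> le; rewrite !pev_revpV//; [|lia|lia].
have -> : x ^+ M = x ^+ (M - g.+1) * x ^+ g.+1.
  by rewrite -exprD subnK//; lia.
by field; rewrite !expf_eq0/= (negPf x0) ?andbF.
Qed.

Hypothesis sep : 2%:R * y - pev x h != 0.
Hypothesis (sh : (size h <= g.+2)%N) (sf : (size f <= (2 * g).+3)%N).

Lemma inverse_eq : u ^+ 2 = pev t hinv * u + pev t finv.
Proof.
rewrite !pev_revp// expr_div_n (chart_eq xy).
have -> : x ^+ (2 * g).+2 = x ^+ g.+1 * x ^+ g.+1 by rewrite -exprD;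
  congr (_ ^+ _); lia.
by field; rewrite expf_eq0 /= (negPf x0).
Qed.

Lemma derivation_x_exp (n : nat) : D (x ^+ n.+1) = n.+1%:R * x ^+ n * D x.
Proof.
have [_ DM _] := chart_der xy.
elim: n => [|n IH]; first by rewrite !expr1 mul1r mul1r.
by rewrite exprS DM IH /GRing.scale /= -[in RHS]natr1 exprS; ring.
Qed.

Lemma derivation_inv z : z != 0 -> D z^-1 = - D z / z ^+ 2.
Proof.
move=> z0; have [_ DM Dc] := chart_der xy.
have : D (z * z^-1) = 0 by rewrite divff// -(rmorph1 (cst K)) Dc.
rewrite DM /GRing.scale /= => E; apply: (mulfI z0).
by apply/eqP; rewrite -subr_eq0; apply/eqP; rewrite -[RHS]E; field.
Qed.

Lemma Dinv_der : is_derivation Dinv.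
Proof.
have [DD DM Dc] := chart_der xy; rewrite /Dinv; split.
- by move=> a b; rewrite DD mulrDr.
- by move=> a b; rewrite DM /GRing.scale /=; ring.
- by move=> c; rewrite Dc mulr0.
Qed.

Lemma inverse_chart : chart t u hinv finv Dinv.
Proof.
have xn n : x ^+ n != 0 by rewrite expf_eq0 (negPf x0) andbF.
have DX : Dinv t = 2%:R * u - pev t hinv.
  rewrite /Dinv derivation_inv// (chart_DX xy) pev_revp// (exprS x g).
  by field; rewrite x0 xn.
split=> //.
- exact: inverse_eq.
- move=> z; have [a [b [c [c0 zE]]]] := chart_span xy z.
  have [|M0 HM] := @affine_ring_inverse (z * pev x c); first by exists a, b.
  pose M := (M0 + size c)%N.
  have [a' [b' E]] := HM M (leq_addr _ _).
  have sc : (size c <= M.+1)%N by rewrite /M; lia.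
  exists a', b', (revp M c); split; last by rewrite pev_revp// mulrA.
  by apply: contra_neq c0 => /revp_eq0; apply.
- move=> a b E; pose M := (size a + size b + g.+1)%N.
  have := affine_ring_inverseV (leqnn M); rewrite E mul0r => /esym.
  move=> /(chart_free xy)[a0 b0].
  split; first by apply: revp_eq0 a0; rewrite /M; lia.
  by apply: revp_eq0 b0; rewrite /M; lia.
- exact: Dinv_der.
(* Differentiating the equation of [u] determines [Dinv u] up to the factor [2 u - hinv(t)], which
   [sep] allows to cancel. *)
have sep' : 2%:R * u - pev t hinv != 0.
  have -> : 2%:R * u - pev t hinv = (2%:R * y - pev x h) / x ^+ g.+1.
    by rewrite pev_revp//; field.
  by rewrite mulf_neq0// invr_eq0.
have [DD DM _] := Dinv_der.
have : Dinv (u ^+ 2) = Dinv (pev t hinv * u + pev t finv) by rewrite inverse_eq.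
rewrite expr2 DD !DM !(derivation_pev _ _ Dinv_der) DX /GRing.scale /= => E.
apply: (mulfI sep'); apply/eqP; rewrite -subr_eq0; apply/eqP.
move/eqP: E; rewrite -subr_eq0 => /eqP E; rewrite -[RHS]E; ring.
Qed.

End InverseChart.

(** * Regular functions on the two affine open sets and their overlap *)

Section Global.
Variables (k : closedFieldType) (K : fieldExtType {fraction {poly k}}).
Local Notation x := (xK K).
Variables (y : K) (h f : {poly k}) (D : K -> K^o) (g : nat).
Hypothesis xy : chart x y h f D.
Hypothesis sep : 2%:R * y - pev x h != 0.
Hypothesis (sh : (size h <= g.+2)%N) (sf : (size f <= (2 * g).+3)%N).
Hypothesis smooth_fin : forall a, smooth_at h f a.
Hypothesis smooth_inf : smooth_at (hinv h g) (finv f g) 0.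

Local Notation t := (x^-1).
Local Notation u := (y / x ^+ g.+1).
Local Notation A := (affine_ring x y).
Local Notation Ainf := (affine_ring t u).
Let x0 : x != 0 := chart_x_neq0 xy.
Let tu := inverse_chart xy sep sh sf.
Let xn n : x ^+ n != 0.
Proof. by rewrite expf_eq0 (negPf x0) andbF. Qed.

Lemma Uof_inftyE (P : point K) : Uof (infty k) P <-> stalk P x.
Proof.
rewrite /Uof /lies_over /=; split=> [nx|Px mx].
  by apply: contrapT => Px; apply: nx; apply: maximal_idealP.
by apply: (maximal_ideal_unit mx Px); rewrite mulVf.
Qed.

Lemma Uof_originE (P : point K) : Uof (origin k) P <-> stalk P t.
Proof.
rewrite /Uof /lies_over /= rmorph0 subr0; split=> [nx|Px mx].
  have [Px|//] := stalk_val P x.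
  by have [] := stalkV Px nx.
by apply: (maximal_ideal_unit mx Px); rewrite divff.
Qed.

Lemma functions_on_infty z : functions_on (Uof (infty k)) z <-> A z.
Proof.
split=> [Uz|Az P /Uof_inftyE Px]; last exact: (stalk_affine_ring xy Px Az).
have [a [b [c [c0 zE]]]] := chart_span xy z.
apply: (regular_affine_ring xy (U := Uof (infty k)) c0) => //.
- by move=> r P _ mx; apply/Uof_inftyE; apply: stalk_X mx.
- by exists a, b.
Qed.

Lemma functions_on_cap z : functions_on (@Ucap k K) z ->
  exists N, A (z * x ^+ N).
Proof.
move=> Uz; have AA := affine_ring_subring xy.
have [a [b [c [c0 zE]]]] := chart_span xy z.
(* The zero of the denominator at 0 is absorbed by [x^N]; the fibres over the roots of [q] then lie
   in the overlap. *)
have [N [q]] := multiplicity_XsubC c 0; rewrite c0 subr0 /root /= => q0 cE.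
exists N.
have qn0 : q != 0 by apply: contra_neq q0 => ->; rewrite horner0.
apply: (regular_affine_ring xy (U := @Ucap k K) qn0) => //.
- move=> r P rr mx; split; last by apply/Uof_inftyE; apply: stalk_X mx.
  rewrite /Uof /lies_over /= => mx0.
  have r0 : r = 0.
    apply: (@maximal_ideal_cst _ _ P).
    rewrite (_ : cst K r = (x - cst K 0) - (x - cst K r)).
      exact: maximal_idealB.
    by rewrite rmorph0; ring.
  by rewrite r0 /root (negPf q0) in rr.
- move=> P UP; apply: stalkM; first exact: Uz.
  by apply: stalkX; apply/Uof_inftyE; case: UP.
- by exists a, b; rewrite -zE cE rmorphM rmorphXn /= pevX; ring.
Qed.

(** Regularity on the overlap already gives [z * x^N] in [A], so in the reciprocal model the only
    denominator is a power of [t], and smoothness there is needed only at [t = 0]. *)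
Lemma functions_on_origin z : functions_on (Uof (origin k)) z <-> Ainf z.
Proof.
split=> [Uz|Az P /Uof_originE Px]; last exact: (stalk_affine_ring tu Px Az).
have [N AN] : exists N, A (z * x ^+ N).
  by apply: functions_on_cap => P [oP _]; apply: Uz.
have [M0 HM] := affine_ring_inverse g xy AN.
have Xn0 : ('X^M0 : {poly k}) != 0 by rewrite expf_neq0// polyX_eq0.
have rX (a : k) : root 'X^M0 a -> a = 0.
  rewrite /root hornerXn expf_eq0 => /andP[_ /eqP //].
apply: (regular_affine_ring tu (U := Uof (origin k)) Xn0) => //.
- by move=> a /rX->.
- by move=> a P _ mx; apply/Uof_originE; apply: stalk_X mx.
rewrite rmorphXn /= pevX.
have -> : z * t ^+ M0 = z * x ^+ N / x ^+ (N + M0) by rewrite exprD exprVn;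
  field; rewrite !xn.
by apply: HM; apply: leq_addl.
Qed.

(** In [x^m Ainf] the coefficient of 1 has degree at most [m] in [x] and that of [y] at most
    [m - g - 1]; freeness of 1 and [y] allows the comparison. *)
Lemma affine_ring_meet (a b : {poly k}) m z :
  Ainf z -> pev x a + pev x b * y = x ^+ m * z ->
  (size a <= m.+1)%N /\ ((m <= g)%N -> b = 0).
Proof.
move=> [a' [b' ->]] E; pose M := (size a' + size b' + g.+1)%N.
have E' := affine_ring_inverseV xy (leqnn M).
have [] := chart_free xy (u := 'X^M * a - 'X^m * revp M a')
   (v := 'X^M * b - 'X^m * revp (M - g.+1) b').
  rewrite !(rmorphB, rmorphM, rmorphXn) /= !pevX.
  transitivity (x ^+ M * (pev x a + pev x b * y) -
    x ^+ m * (pev x (revp M a') + pev x (revp (M - g.+1) b') * y));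
      first by ring.
  by rewrite E -E'; ring.
move=> /eqP; rewrite subr_eq0 => /eqP aE /eqP; rewrite subr_eq0 => /eqP bE.
have sXn n (p : {poly k}) : (size ('X^n * p)%R <= n + size p)%N.
  by apply: leq_trans (size_polyMleq _ _) _; rewrite size_polyXn; lia.
have sXn' n (p : {poly k}) : p != 0 -> size ('X^n * p)%R = (n + size p)%N.
  by move=> p0; rewrite mulrC size_Mmonic ?monicXn// size_polyXn; lia.
split.
  have [->|a0] := eqVneq a 0; first by rewrite size_poly0.
  have := sXn m (revp M a'); rewrite -aE (sXn' _ _ a0).
  by have := size_revp M a'; lia.
move=> mg; apply/eqP; apply: contraT => b0.
have := sXn m (revp (M - g.+1) b'); rewrite -bE (sXn' _ _ b0).
have := size_revp (M - g.+1) b'; have : (size b != 0)%N by rewrite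
  size_poly_eq0.
have : (g.+1 <= M)%N by apply: leq_addl.
by move: mg; lia.
Qed.

(** * Regular differentials in the coordinate [phi] *)

Section Differentials.
Variables (Om : kaehler K) (phi : Om -> K).
Hypothesis phiD : forall v w, phi (v + w) = phi v + phi w.
Hypothesis phiZ : forall a w, phi (a *: w) = a * phi w.
Hypothesis phi_diff : forall z, phi (diff Om z) = D z.
Hypothesis phi_inj : injective phi.

Lemma phi0 : phi 0 = 0.
Proof. by rewrite -(scale0r 0) phiZ mul0r. Qed.

Lemma phi_sum (I : Type) (r : seq I) (F : I -> Om) :
  phi (\sum_(i <- r) F i) = \sum_(i <- r) phi (F i).
Proof. exact: (big_morph phi phiD phi0). Qed.

(** [D'] preserves the local ring and takes a unit value on it, so the differential dual to [D']
    generates the stalk. The factor [e] relates the chart to [phi]: it is 1 on the finite chart and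
    [- x / x^g] at infinity. *)
Lemma stalk_diff_chart (X Y : K) (h' f' : {poly k}) (D' : K -> K^o) e P a w :
  chart X Y h' f' D' -> (forall z, D' z = e * D z) -> e != 0 ->
  maximal_ideal P (X - cst K a) -> smooth_at h' f' a ->
  stalk_diff P w <-> stalk P (e * phi w).
Proof.
move=> XY D'E e0 mX sm; split.
  move=> [s sP ->]; rewrite phi_sum mulr_sumr big_seq.
  apply: stalk_sum => j /sP[P1 P2]; rewrite phiZ phi_diff mulrCA -D'E.
  by apply: stalkM => //; apply: (derivation_stalk XY mX sm P2).
move=> Pw; have [b [q [Pb Pq bq]]] := derivation_stalk_unit XY mX sm.
exists [:: (e * phi w * b, q)].
  by move=> j; rewrite inE => /eqP->; split=> //; apply: stalkM.
apply: phi_inj; rewrite big_seq1 phiZ phi_diff /=.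
by rewrite -[LHS]mulr1 -bq D'E; ring.
Qed.

Lemma diffs_on_infty w :
  diffs_on (Uof (infty k)) w <-> functions_on (Uof (infty k)) (phi w).
Proof.
have E P : Uof (infty k) P -> stalk_diff P w <-> stalk P (phi w).
  move=> /Uof_inftyE Px; have [a mx] := exists_residue xy Px.
  rewrite (stalk_diff_chart w xy (e := 1) _ (oner_neq0 _) mx (@smooth_fin a))
    ?mul1r//.
  by move=> z; rewrite mul1r.
by split=> H P UP; apply/E => //; apply: H.
Qed.

Lemma diffs_on_origin w :
  diffs_on (Uof (origin k)) w <-> functions_on (Uof (origin k)) (x / x ^+ g *
    phi w).
Proof.
have E P : Uof (origin k) P -> stalk_diff P w <-> stalk P (x / x ^+ g * phi w).
  move=> /Uof_originE Pt.
  (* Away from infinity the finite chart applies and [x] is a unit; over infinity the reciprocal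
     chart is used at [t = 0]. *)
  have [Px|Px] := pselect (stalk P x).
    have [a mx] := exists_residue xy Px.
    have := stalk_diff_chart w xy (e := 1) _ (oner_neq0 _) mx (@smooth_fin a).
    rewrite mul1r => -> //; last by move=> z; rewrite mul1r.
    split=> Pw; first by rewrite -exprVn; do !apply: stalkM => //;
      apply: stalkX.
    have -> : phi w = x ^+ g * t * (x / x ^+ g * phi w) by field; rewrite x0 xn.
    by do !apply: stalkM => //; apply: stalkX.
  have mt : maximal_ideal P (t - cst K 0).
    by rewrite rmorph0 subr0; apply: maximal_idealP.
  have e0 : - (x / x ^+ g) != 0 by rewrite oppr_eq0 mulf_neq0 ?invr_eq0.
  rewrite (stalk_diff_chart w tu _ e0 mt smooth_inf)//.
  by rewrite mulNr; split=> /stalkN; rewrite ?opprK.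
by split=> H P UP; apply/E => //; apply: H.
Qed.

End Differentials.
End Global.

(** * Cohomology of a smooth model *)

(** Expanding each basis in the other gives matrices with [M *m N = 1], which bounds one size by the
    other. *)
Lemma is_basis_card (k : fieldType) (V : lmodType k) m n
    (v : 'I_m -> V) (w : 'I_n -> V) : is_basis v -> is_basis w -> m = n.
Proof.
suff le p q (a : 'I_p -> V) (b : 'I_q -> V) :
    is_basis a -> is_basis b -> (p <= q)%N.
  by move=> bv bw; apply/eqP; rewrite eqn_leq !(le _ _ _ _ bv bw, le _ _ _ _ bw
    bv).
move=> [fa sa] [fb sb].
have [M aE] : exists M : 'M[k]_(p, q), forall i, a i = \sum_j M i j *: b j.
  have [F FE] := choice (fun i => sb (a i)).
  by exists (\matrix_(i, j) F i j) => i; rewrite FE; apply: eq_bigr => j;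
    rewrite mxE.
have [N bE] : exists N : 'M[k]_(q, p), forall i, b i = \sum_j N i j *: a j.
  have [F FE] := choice (fun i => sa (b i)).
  by exists (\matrix_(i, j) F i j) => i; rewrite FE; apply: eq_bigr => j;
    rewrite mxE.
apply: (@mulmx1_min _ _ _ M N); apply/matrixP => i j.
apply/eqP; rewrite -subr_eq0; apply/eqP.
apply: (fa (fun j => (M *m N) i j - (1%:M : 'M_p) i j)).
under eq_bigr do rewrite scalerBl.
rewrite sumrB; apply/eqP; rewrite subr_eq0; apply/eqP.
transitivity (a i); last first.
  rewrite (bigD1 i)//= mxE eqxx scale1r big1 ?addr0// => l li.
  by rewrite mxE eq_sym (negPf li) scale0r.
rewrite [RHS]aE.
under eq_bigr do rewrite mxE scaler_suml.
rewrite exchange_big /=; apply: eq_bigr => l _.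
by rewrite bE scaler_sumr; apply: eq_bigr => j' _; rewrite scalerA.
Qed.

(** * Bases of a quotient module *)

Section QuotientFamilies.
Variables (k : fieldType) (V : lmodType k) (B : pred V) (Bc : submod_closed B).

Lemma qclass0 : qclass Bc 0 = 0.
Proof. by apply: (addIr (qclass Bc 0)); rewrite add0r -qclassD addr0. Qed.

Lemma qclass_sum (J : finType) (c : J -> k) (v : J -> V) :
  \sum_j c j *: (qclass Bc (v j) : quotmod Bc) = qclass Bc (\sum_j c j *: v j).
Proof.
rewrite (big_morph (qclass Bc) (qclassD Bc) qclass0).
by apply: eq_bigr => j _; rewrite qclassZ.
Qed.

Lemma is_basis_quot (J : finType) (v : J -> V) :
  (forall c : J -> k, B (\sum_j c j *: v j) -> forall j, c j = 0) ->
  (forall w : V, exists c : J -> k, B (w - \sum_j c j *: v j)) ->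
  is_basis (fun j => qclass Bc (v j) : quotmod Bc).
Proof.
move=> fr sp; split=> [c|w].
  by rewrite qclass_sum -qclass0 => /qclassP; rewrite subr0; apply: fr.
have [c Bw] := sp (repr (w : Quotient.quot (submod_pred Bc))).
exists c; rewrite qclass_sum -[w in LHS](qclass_repr w).
exact/qclassP.
Qed.

End QuotientFamilies.

(** * Global differentials, the genus, and functions on the overlap *)

Section Cohomology.
Variables (k : closedFieldType) (K : fieldExtType {fraction {poly k}}).
Local Notation x := (xK K).
Variables (y : K) (h f : {poly k}) (D : K -> K^o) (g : nat).
Hypothesis xy : chart x y h f D.
Hypothesis sep : 2%:R * y - pev x h != 0.
Hypothesis (sh : (size h <= g.+2)%N) (sf : (size f <= (2 * g).+3)%N).
Hypothesis smooth_fin : forall a, smooth_at h f a.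
Hypothesis smooth_inf : smooth_at (hinv h g) (finv f g) 0.
Variables (Om : kaehler K) (phi : Om -> K).
Hypothesis phiD : forall v w, phi (v + w) = phi v + phi w.
Hypothesis phiZ : forall a w, phi (a *: w) = a * phi w.
Hypothesis phi_diff : forall z, phi (diff Om z) = D z.
Hypothesis phi_inj : injective phi.
Variable eta : Om.
Hypothesis phi_eta : phi eta = 1.

Local Notation t := (x^-1).
Local Notation u := (y / x ^+ g.+1).
Local Notation A := (affine_ring x y).
Local Notation Ainf := (affine_ring t u).
Let x0 : x != 0 := chart_x_neq0 xy.
Let xn n : x ^+ n != 0.
Proof. by rewrite expf_eq0 (negPf x0) andbF. Qed.
Let tu := inverse_chart xy sep sh sf.
Let fun_infty := functions_on_infty xy smooth_fin.
Let fun_origin := functions_on_origin xy sep sh sf smooth_fin smooth_inf.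
Let diffs_infty := diffs_on_infty xy smooth_fin phiD phiZ phi_diff phi_inj.
Let diffs_origin := diffs_on_origin xy sep sh sf smooth_fin smooth_inf
  phiD phiZ phi_diff phi_inj.
Let phi0' : phi 0 = 0 := phi0 phiZ.

Lemma diffs_on_all (w : Om) : diffs_on (fun _ : point K => True) w <->
  diffs_on (Uof (origin k)) w /\ diffs_on (Uof (infty k)) w.
Proof.
split=> [H|[H0 Hoo] P _]; first by split=> P _; apply: H.
have [Px|Pt] := stalk_val P x; first exact/Hoo/(Uof_inftyE xy).
by apply: H0; apply/(Uof_originE xy).
Qed.

Lemma diffs_on_allE (w : Om) : diffs_on (fun _ : point K => True) w <->
  exists2 a : {poly k}, (size a <= g)%N & phi w = pev x a.
Proof.
split=> [/diffs_on_all[/diffs_origin/fun_origin W0 /diffs_infty/fun_infty]|].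
  move=> [a [b wE]].
  (* Since [x / x^g * phi w] is in [Ainf], multiplying [phi w] by [x] fits the case [m = g]:
     ['X * a] has degree at most [g], and [b] vanishes. *)
  have [|sa b0] := affine_ring_meet xy sh sf (a := 'X * a) (b := 'X * b) (m :=
    g) W0.
    by rewrite !rmorphM /= pevX -!mulrA -mulrDr -wE; field; exact: xn.
  have {}b0 : b = 0.
    by apply/eqP; have/eqP := b0 (leqnn g); rewrite mulf_eq0 polyX_eq0.
  exists a; last by rewrite wE b0 rmorph0 mul0r addr0.
  have [->|a0] := eqVneq a 0; first by rewrite size_poly0.
  by move: sa; rewrite mulrC size_mulX.
move=> [a sa wE]; apply/diffs_on_all; split.
  apply/diffs_origin/fun_origin; rewrite wE.
  move: sa; have [->|m0] := eqVneq g 0%N => sa.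
    have -> : a = 0 by apply/eqP; rewrite -size_poly_leq0.
    by rewrite rmorph0 mulr0; exists 0, 0; rewrite !rmorph0 mul0r addr0.
  exists (revp g.-1 a), 0; rewrite rmorph0 mul0r addr0 pev_revp// ?prednK
    ?lt0n//.
  rewrite -[in LHS](prednK (n := g)) ?lt0n// exprS.
  by field; rewrite x0 xn.
by apply/diffs_infty/fun_infty; rewrite wE; apply: affine_ring_pev.
Qed.

Lemma pev_poly_sum n (c : 'I_n -> k) :
  \sum_i cst K (c i) * x ^+ i = pev x (\sum_i c i *: 'X^i).
Proof.
rewrite rmorph_sum /=; apply: eq_bigr => i _.
by rewrite pevZ rmorphXn /= pevX.
Qed.

Lemma coef_poly_sum n (c : 'I_n -> k) (i : 'I_n) :
  (\sum_(j < n) c j *: 'X^j)`_i = c i.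
Proof.
rewrite coef_sum (bigD1 i)//= coefZ coefXn eqxx mulr1 big1 ?addr0// => j ji.
by rewrite coefZ coefXn eq_sym (negPf (_ : (j : nat) != i)) ?mulr0.
Qed.

Lemma monomials_free n (c : 'I_n -> k) :
  \sum_i cst K (c i) * x ^+ i = 0 -> forall i, c i = 0.
Proof.
rewrite pev_poly_sum => /(chart_pev_eq0 xy) E i.
by rewrite -coef_poly_sum E coef0.
Qed.

Lemma phi_monomial i : phi (x ^+ i *: eta) = x ^+ i.
Proof. by rewrite phiZ phi_eta mulr1. Qed.

(** The forms [x^i eta] with [i < g] are a basis of the global differentials, so the genus is the
    [g] of any smooth model. *)
Lemma has_genus_unique g' : has_genus Om g' -> g' = g.
Proof.
move=> [v bv].
have eH (i : 'I_g) : (x ^+ i *: eta : restr Om) \in @H0Omega_pred k K Om.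
  rewrite unfold_in; apply/asboolP/diffs_on_allE; exists 'X^i.
    by rewrite size_polyXn.
  by rewrite phi_monomial rmorphXn /= pevX.
pose e (i : 'I_g) : H0Omega Om :=
  exist (fun w : restr Om => w \in @H0Omega_pred k K Om) _ (eH i).
apply: (is_basis_card bv (w := e)).
have valE c : phi (val (\sum_i c i *: e i)) = \sum_i cst K (c i) * x ^+ i.
  rewrite raddf_sum /=.
  rewrite (phi_sum phiD phiZ); apply: eq_bigr => i _.
  by rewrite -[in RHS]phi_monomial -phiZ.
split=> [c E|w].
  by apply: monomials_free; rewrite -valE E.
have /asboolP/diffs_on_allE[a sa wE] := valP w.
exists (fun i : 'I_g => a`_i); apply/val_inj/phi_inj.
by rewrite valE wE (pev_wide x sa).
Qed.

(** The monomials [x^j] lie in [A] or [Ainf]; [x^j y] lies in [A] for [j >= 0] and in [Ainf] for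
    [j <= - g - 1]. The exponents in between give the [y / x^i] with [1 <= i <= g]. *)
Lemma functions_on_cap_split z : functions_on (@Ucap k K) z ->
  exists c : 'I_g -> k, exists z0 zoo, [/\ functions_on (Uof (origin k)) z0,
    functions_on (Uof (infty k)) zoo &
    z = \sum_i cst K (c i) * (y / x ^+ i.+1) + (z0 - zoo)].
Proof.
have AA := affine_ring_subring xy; have AAi := affine_ring_subring tu.
pose S z := exists c : 'I_g -> k, exists z0 zoo, [/\ Ainf z0, A zoo &
    z = \sum_i cst K (c i) * (y / x ^+ i.+1) + (z0 - zoo)].
have SA v : A v -> S v.
  move=> Av; exists (fun=> 0), 0, (- v); split.
  - exact: subring0.
  - exact: subringN.
  - by rewrite big1 => [|i _]; rewrite ?rmorph0 ?mul0r// !add0r opprK.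
have SAi v : Ainf v -> S v.
  move=> Av; exists (fun=> 0), v, 0; split=> //; first exact: subring0.
  by rewrite big1 => [|i _]; rewrite ?rmorph0 ?mul0r// add0r subr0.
have SD v w : S v -> S w -> S (v + w).
  move=> [c [v0 [voo [Av0 Avoo ->]]]] [d [w0 [woo [Aw0 Awoo ->]]]].
  exists (fun i => c i + d i), (v0 + w0), (voo + woo); split.
  - exact: subringD.
  - exact: subringD.
  - under [in RHS]eq_bigr do rewrite rmorphD mulrDl.
    by rewrite big_split /=; ring.
have SZ e v : S v -> S (cst K e * v).
  move=> [c [v0 [voo [Av0 Avoo ->]]]].
  exists (fun i => e * c i), (cst K e * v0), (cst K e * voo); split.
  - by apply: subringM => //; rewrite -(pevC t); apply: affine_ring_pev.
  - by apply: subringM => //; rewrite -(pevC x); apply: affine_ring_pev.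
  - under [in RHS]eq_bigr do rewrite rmorphM -mulrA.
    by rewrite -mulr_sumr /=; ring.
have Ax n : A (x ^+ n).
  by have := affine_ring_pev x y 'X^n; rewrite rmorphXn /= pevX.
have Ait n : Ainf (t ^+ n).
  by have := affine_ring_pev t u 'X^n; rewrite rmorphXn /= pevX.
have Ssum n (F : 'I_n -> K) : (forall i, S (F i)) -> S (\sum_i F i).
  by move=> SF; elim/big_ind: _ => //; apply: SA; exact: subring0.
have ge i n : (n <= i)%N -> x ^+ i / x ^+ n = x ^+ (i - n).
  by move=> ni; rewrite -{1}(subnK ni) exprD mulfK.
have lt i n : (i < n)%N -> x ^+ i / x ^+ n = t ^+ (n - i).
  by move=> /ltnW ni; rewrite exprVn -ge// invf_div.
have Sx i n : S (x ^+ i / x ^+ n).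
  by have [/ge->|/lt->] := leqP n i; [apply: SA | apply: SAi].
have Sy i n : S (x ^+ i / x ^+ n * y).
  have [/ge->|ni] := leqP n i.
    by apply: SA; apply: subringM => //; apply: affine_ring_Y.
  rewrite lt//.
  have [gn|gn] := ltnP g (n - i).
    have -> : t ^+ (n - i) * y = t ^+ (n - i - g.+1) * u.
      rewrite [y / _]mulrC mulrA -exprVn -exprD subnK//.
    by apply: SAi; apply: subringM => //; apply: affine_ring_Y.
  (* The index [j] stands for [y / x^(j+1)], hence the predecessor. *)
  have lg : ((n - i).-1 < g)%N by lia.
  exists (fun j => (j == Ordinal lg)%:R), 0, 0; split; [exact: subring0..|].
  rewrite (bigD1 (Ordinal lg))//= eqxx rmorph1 mul1r big1; last first.
    by move=> j /negPf->; rewrite rmorph0 mul0r.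
  by rewrite subrr !addr0 prednK ?subn_gt0// exprVn mulrC.
move=> /(functions_on_cap xy smooth_fin)[N [a [b zE]]].
suff [c [z0 [zoo [Az0 Azoo zE']]]] : S z.
  by exists c, z0, zoo; split=> //; [apply/fun_origin|apply/fun_infty].
rewrite -(mulfK (xn N) z) zE (pevE x a) (pevE x b) mulrDl mulrAC !mulr_suml.
apply: SD; apply: Ssum => i; first by rewrite -mulrA; apply: SZ.
by rewrite -!mulrA; apply: SZ; rewrite mulrA; apply: Sy.
Qed.

Lemma split_unique (c : 'I_g -> k) z0 zoo :
  functions_on (Uof (origin k)) z0 -> functions_on (Uof (infty k)) zoo ->
  \sum_i cst K (c i) * (y / x ^+ i.+1) = z0 - zoo ->
  (forall i, c i = 0) /\ exists e, zoo = cst K e.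
Proof.
move=> /fun_origin Az0 /fun_infty[a [b zooE]] E.
(* Multiplication by [x^g] turns [y / x^(i+1)] into [x^(g-1-i) y], hence the reversed indices. *)
pose q : {poly k} := \sum_(i < g) c (rev_ord i) *: 'X^i.
have qE : x ^+ g * (\sum_i cst K (c i) * (y / x ^+ i.+1)) = pev x q * y.
  rewrite -pev_poly_sum mulr_sumr mulr_suml (reindex_inj rev_ord_inj).
  apply: eq_bigr => i _ /=.
  have -> : x ^+ g = x ^+ i * x ^+ (g - i.+1).+1.
    by rewrite -exprD; congr (_ ^+ _); have := ltn_ord i; lia.
  by field; exact: xn.
have [|sa b0] := affine_ring_meet xy sh sf (a := 'X^g * a) (b := 'X^g * b + q)
  (m := g) Az0.
  rewrite rmorphD !rmorphM rmorphXn /= pevX.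
  transitivity (x ^+ g * zoo + pev x q * y); first by rewrite zooE; ring.
  by rewrite -qE E; ring.
have {}b0 := b0 (leqnn g).
have qc i : q`_i = 0.
  have [gi|ig] := leqP g i.
    rewrite coef_sum big1// => j _; rewrite coefZ coefXn.
    by rewrite (_ : (i == j) = false) ?mulr0//; have := ltn_ord j; lia.
  by have := congr1 (fun p : {poly k} => p`_i) b0;
    rewrite coefD coefXnM ig add0r coef0.
have q0 : q = 0 by apply/polyP => i; rewrite qc coef0.
split=> [i|]; first by have := qc (rev_ord i); rewrite coef_poly_sum rev_ordK.
have {}b0 : b = 0.
  by move/eqP: b0; rewrite q0 addr0 mulf_eq0 expf_eq0 polyX_eq0 andbF /= =>
    /eqP.
(* Now [zoo] is [a(x)], and the degree bound [g] on ['X^g * a] leaves only a constant. *)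
exists a`_0%N; rewrite zooE b0 rmorph0 mul0r addr0 -(pevC x); congr pev.
apply: size1_polyC; have [->|a0] := eqVneq a 0; first by rewrite size_poly0.
by move: sa; rewrite mulrC size_Mmonic ?monicXn// size_polyXn; lia.
Qed.

(** * Assembling the basis of the de Rham cohomology *)

Section Basis.
Variables (e : k) (gamma lambda : nat -> triple Om) (w : nat -> Om).
Hypothesis e0 : e != 0.
Hypothesis gammaZ : forall i : 'I_g, dR_cocycle (gamma i.+1).
Hypothesis gammaE : forall i : 'I_g, (gamma i.+1).2 = y / x ^+ i.+1.
Hypothesis lambdaE : forall i, lambda i = mktriple (w i) (w i) 0.
Hypothesis phi_w : forall i, phi (w i) = cst K e * x ^+ i.

Lemma lambda_cocycle (i : 'I_g) : dR_cocycle (lambda i).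
Proof.
have /diffs_on_all[w0 woo] : diffs_on (fun _ : point K => True) (w i).
  apply/diffs_on_allE; exists (e *: 'X^i).
    by rewrite size_scale// size_polyXn.
  by rewrite phi_w pevZ rmorphXn /= pevX.
rewrite lambdaE; split=> //; first exact: functions_on0.
by rewrite subrr; apply: diff0.
Qed.

(** The exact sequence from [H^0(Omega)] through [H^1_dR] to [H^1(O)] made explicit: third
    components determine the coefficients of the [gamma], and what remains is a global differential,
    a unique combination of the [lambda]. *)
Lemma basis_H1dR : classes_form_basis g gamma lambda.
Proof.
exists gammaZ, lambda_cocycle.
pose v (j : 'I_g + 'I_g) : Z1dR Om := match j with
  | inl i => exist _ (gamma i.+1) (asboolT (gammaZ i))
  | inr i => exist _ (lambda i) (asboolT (lambda_cocycle i)) end.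
suff bv : is_basis (fun j => qclass (@B1dR_closed _ _ Om) (v j)
    : quotmod (@B1dR_closed _ _ Om)).
  by move: bv; congr is_basis; apply: funext; case.
have valE (c : 'I_g + 'I_g -> k) : val (\sum_j c j *: v j) =
    \sum_i c (inl i) *: gamma i.+1 + \sum_i c (inr i) *: lambda i.
  by rewrite raddf_sum big_sumType.
have val2 (c : 'I_g + 'I_g -> k) : (val (\sum_j c j *: v j)).2 =
    \sum_i cst K (c (inl i)) * (y / x ^+ i.+1).
  rewrite valE -[LHS]/((_ : triple Om).2 + (_ : triple Om).2).
  rewrite !(big_morph (fun s : triple Om => s.2) (id1 := 0) (op1 := +%R))//.
  rewrite [X in _ + X]big1 ?addr0 => [|i _]; last first.
    by rewrite lambdaE; apply: scaler0.
  by apply: eq_bigr => i _; rewrite -gammaE.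
have val1 (c : 'I_g + 'I_g -> k) : phi (val (\sum_j c j *: v j)).1.2 =
    \sum_i cst K (c (inl i)) * phi (gamma i.+1).1.2 +
    cst K e * \sum_i cst K (c (inr i)) * x ^+ i.
  rewrite valE -[LHS]/(phi ((_ : triple Om).1.2 + (_ : triple Om).1.2)).
  rewrite !(big_morph (fun s : triple Om => s.1.2) (id1 := 0) (op1 := +%R))//.
  rewrite phiD mulr_sumr !(phi_sum phiD phiZ).
  congr (_ + _); apply: eq_bigr => i _; first exact: phiZ.
  by rewrite lambdaE mulrCA -phi_w -phiZ.
have cocycleP (s : Z1dR Om) : dR_cocycle (val s) := asboolW (valP s).
apply: is_basis_quot => [c|s].
  (* The third component kills the coefficients of [gamma] and makes [zoo] constant; then
     [d zoo = 0] leaves a vanishing combination of the [x^i]. *)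
  move=> /asboolP[z0 [zoo [z0P zooP E]]].
  have E2 := congr1 snd E; rewrite val2 /= in E2.
  have [c0 [d zooE]] := split_unique z0P zooP E2.
  have := val1 c; rewrite E /= big1 => [|i _]; last by rewrite c0 rmorph0 mul0r.
  have [_ _ dc] := diff_der Om.
  rewrite zooE dc phi0' add0r => /esym/eqP;
    rewrite mulf_eq0 fmorph_eq0 (negPf e0) /=.
  by move=> /eqP/monomials_free d0 [].
have [_ _ zP _] : dR_cocycle ((val s).1.1, (val s).1.2, (val s).2).
  by have := cocycleP s; case: (val s) => -[].
have [c [z0 [zoo [z0P zooP zE]]]] := functions_on_cap_split zP.
have res2 (c' : 'I_g + 'I_g -> k) : (forall i, c' (inl i) = c i) ->
    (val (s - \sum_j c' j *: v j)).2 = z0 - zoo.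
  move=> cE; transitivity ((val s).2 - (val (\sum_j c' j *: v j)).2) => //.
  rewrite val2 {1}zE [X in _ - X](eq_bigr (fun i => cst K (c i) * (y / x ^+
    i.+1))).
    by rewrite addrC addKr.
  by move=> i _; rewrite cE.
have phiB v1 v2 : phi (v1 - v2) = phi v1 - phi v2.
  by rewrite phiD -scaleN1r phiZ mulN1r.
have res1 (c' : 'I_g + 'I_g -> k) : phi (val (s - \sum_j c' j *: v j)).1.2 =
    phi (val s).1.2 - (\sum_i cst K (c' (inl i)) * phi (gamma i.+1).1.2 +
    cst K e * \sum_i cst K (c' (inr i)) * x ^+ i).
  by rewrite -val1 -phiB.
pose c1 (j : 'I_g + 'I_g) := if j is inl i then c i else 0.
(* After removing the [gamma] part and the coboundary of [(z0, zoo)] the third component is 0, so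
   the two forms agree and are a global differential, with coordinate [a(x)]. *)
have [a sa aE] : exists2 a : {poly k}, (size a <= g)%N &
    phi (val (s - \sum_j c1 j *: v j)).1.2 - D zoo = pev x a.
  have := cocycleP (s - \sum_j c1 j *: v j); have := res2 c1 (fun=> erefl).
  case: (val _) => [[r0 roo] r] /= rE [r0P rooP rP dr].
  rewrite -phi_diff -phiB; apply/diffs_on_allE/diffs_on_all.
  have d1 U z' : functions_on U z' -> diffs_on U (diff Om z').
    move=> Uz P UP; exists [:: (1, z')]; last by rewrite big_seq1 scale1r.
    by move=> j; rewrite inE => /eqP->; split; [exact: stalk1 | exact: Uz].
  have dB U w1 w2 : diffs_on U w1 -> diffs_on U w2 -> diffs_on U (w1 - w2).
    move=> Uw1 Uw2; have := diffs_onZD (-1) Uw2 Uw1.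
    by rewrite rmorphN rmorph1 scaleN1r addrC.
  split; last by apply: dB => //; apply: d1.
  have -> : roo - diff Om zoo = r0 - diff Om z0.
    apply/phi_inj; have := congr1 phi dr; rewrite !phiB !phi_diff rE.
    have [DD _ _] := chart_der xy.
    have -> : D (z0 - zoo) = D z0 - D zoo.
      by apply/eqP; rewrite eq_sym subr_eq -DD subrK.
    move=> E; apply/eqP; rewrite -subr_eq0; apply/eqP.
    by rewrite -[RHS](subrr (D z0 - D zoo)) {2}E; ring.
  by apply: dB => //; apply: d1.
pose c' (j : 'I_g + 'I_g) := match j with inl i => c i | inr i => a`_i / e end.
exists c'; apply/asboolP; exists z0, zoo; split=> //.
have := cocycleP (s - \sum_j c' j *: v j); have := res2 c' (fun=> erefl).
have : phi (val (s - \sum_j c' j *: v j)).1.2 = D zoo.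
  rewrite res1 /= opprD addrA.
  have := aE; rewrite res1 /= (pev_wide x sa).
  rewrite [X in cst K e * X]big1 => [|i _]; last by rewrite rmorph0 mul0r.
  rewrite mulr0 addr0 => /eqP; rewrite subr_eq => /eqP->.
  rewrite mulr_sumr; apply/eqP; rewrite subr_eq addrC; apply/eqP; congr (_ + _).
  apply: eq_bigr => i _; rewrite mulrA -rmorphM; congr (cst K _ * _).
  by rewrite mulrC divfK.
case: (val _) => [[r0 roo] r] /= rooE rE [_ _ _ dr].
have {}rooE : roo = diff Om zoo by apply: phi_inj; rewrite rooE phi_diff.
congr (_, _, _) => //.
apply: phi_inj; have := congr1 phi dr; rewrite phiB rooE rE !phi_diff.
have [DD _ _] := chart_der xy.
have -> : D (z0 - zoo) = D z0 - D zoo.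
  by apply/eqP; rewrite eq_sym subr_eq -DD subrK.
by move=> /addIr.
Qed.

End Basis.
End Cohomology.

Lemma aboveE (k : closedFieldType) m (p : {poly k}) :
  above m p = drop_poly m.+1 p * 'X^(m.+1).
Proof.
apply/polyP => j; rewrite coef_poly coefMXn coef_drop_poly ltnS.
have [mj|jm] := ltnP m j; last by rewrite if_same.
by rewrite subnK//; case: ltnP => // pj; rewrite nth_default.
Qed.

(** * The triples gamma are cocycles *)

Section Gamma.
Variables (k : closedFieldType) (K : fieldExtType {fraction {poly k}}).
Local Notation x := (xK K).
Variables (y : K) (h f : {poly k}) (D : K -> K^o) (g : nat).
Hypothesis xy : chart x y h f D.
Hypothesis sep : 2%:R * y - pev x h != 0.
Hypothesis (sh : (size h <= g.+2)%N) (sf : (size f <= (2 * g).+3)%N).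
Hypothesis smooth_fin : forall a, smooth_at h f a.
Hypothesis smooth_inf : smooth_at (hinv h g) (finv f g) 0.
Variables (Om : kaehler K) (phi : Om -> K).
Hypothesis phiD : forall v w, phi (v + w) = phi v + phi w.
Hypothesis phiZ : forall a w, phi (a *: w) = a * phi w.
Hypothesis phi_diff : forall z, phi (diff Om z) = D z.
Hypothesis phi_inj : injective phi.

Let x0 : x != 0 := chart_x_neq0 xy.
Let xn n : x ^+ n != 0.
Proof. by rewrite expf_eq0 (negPf x0) andbF. Qed.

Lemma pev_split m (p : {poly k}) :
  pev x (upto m p) + pev x (above m p) = pev x p.
Proof.
rewrite -rmorphD /= aboveE -[upto m p]/(take_poly m.+1 p).
by rewrite poly_take_drop.
Qed.

Lemma pev_above m (p : {poly k}) :
  pev x (above m p) = pev x (drop_poly m.+1 p) * x ^+ m.+1.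
Proof. by rewrite aboveE rmorphM rmorphXn /= pevX. Qed.

(** Reducing [y^2] by the equation gives [D (y / x^i) = (s_ f i + s_y i * y) / x^(i+1)], with
    polynomials evaluated at [x]. *)
Definition s_y (i : nat) : {poly k} := 'X * h^`() - i%:R *: h.

(* The coefficient of [x^i y] in [s_i] cancels, so that the truncation to
   exponents [<= i] has a pole of small enough order at infinity. *)
Lemma size_upto_s_y i : (size (upto i (s_y i)) <= i)%N.
Proof.
apply/leq_sizeP => j ij; rewrite coef_poly ltnS.
case: leqP => // ji; have -> : j = i by apply/eqP; rewrite eqn_leq ij ji.
rewrite /s_y coefB coefXM coefZ; case: i {ij ji} => [|i] /=.
  by rewrite mul0r subr0.
by rewrite coef_deriv mulr_natl subrr.
Qed.

(** [d (y / x^i)] is cut by exponents of [x]: the low part is regular away from 0, while the high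
    part is divisible by [x^(i+1)] and so is regular away from infinity. *)
Lemma gamma_cocycle i (w0 woo : Om) : (0 < i)%N -> (i <= g)%N ->
  phi w0 = (pev x (upto i (s_ f i)) + pev x (upto i (s_y i)) * y) / x ^+ i.+1 ->
  phi woo =
    - ((pev x (above i (s_ f i)) + pev x (above i (s_y i)) * y) / x ^+ i.+1) ->
  dR_cocycle (mktriple w0 woo (y / x ^+ i)).
Proof.
move=> i0 ig w0E wooE; split.
- apply/(diffs_on_origin xy sep sh sf smooth_fin smooth_inf phiD phiZ phi_diff
  phi_inj).
  apply/(functions_on_origin xy sep sh sf smooth_fin smooth_inf); rewrite w0E.
  (* After multiplication by [x / x^g] the two parts are [t^g] times a polynomial over [x^i], and
     [u] times a polynomial over [x^(i-1)]; the latter relies on [size_upto_s_y]. *)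
  exists ('X^g * revp i (upto i (s_ f i))), (revp i.-1 (upto i (s_y i))).
  have s1 : (size (upto i (s_ f i)) <= i.+1)%N by apply: size_poly.
  have s2 : (size (upto i (s_y i)) <= i.-1.+1)%N.
    by rewrite prednK// size_upto_s_y.
  rewrite rmorphM rmorphXn /= pevX !pev_revp//.
  case: i i0 {ig w0E wooE s1 s2} => // i _ /=; rewrite !exprS exprVn.
  by field; rewrite x0 !xn.
- apply/(diffs_on_infty xy smooth_fin phiD phiZ phi_diff phi_inj).
  apply/(functions_on_infty xy smooth_fin); rewrite wooE.
  exists (- drop_poly i.+1 (s_ f i)), (- drop_poly i.+1 (s_y i)).
  by rewrite !pev_above !rmorphN /=; field; exact: xn.
- move=> P [/(Uof_originE xy) Pt /(Uof_inftyE xy) Px].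
  apply: stalkM; first exact: (stalk_Y xy Px).
  by rewrite -exprVn; apply: stalkX.
apply: phi_inj; rewrite phi_diff.
have -> : phi (w0 - woo) = phi w0 - phi woo.
  by rewrite phiD -scaleN1r phiZ mulN1r.
rewrite w0E wooE opprK -mulrDl addrACA -mulrDl !pev_split.
have [DD DM _] := chart_der xy.
have Dxi : D (x ^+ i) = i%:R * x ^+ i.-1 * D x.
  by rewrite -{1}(prednK i0) (derivation_x_exp xy) prednK.
rewrite DM (derivation_inv xy (xn i)) Dxi /GRing.scale /=.
rewrite (chart_DX xy) (chart_DY xy).
have xi : x ^+ i = x ^+ i.-1 * x by rewrite -exprSr prednK.
rewrite /s_ /s_y !(rmorphB, rmorphM) /= !pevX !pevZ !rmorph_nat.
rewrite (exprSr x i) xi.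
have yE : y ^+ 2 = pev x h * y + pev x f := chart_eq xy.
set H := pev x h in yE *; set F := pev x f in yE *.
(* Eliminating [f] through the curve equation leaves a formal identity for [field]. *)
have -> : F = y ^+ 2 - H * y by rewrite yE addrC addKr.
by rewrite natrM; field; rewrite x0 xn.
Qed.

End Gamma.

(** * Smoothness at infinity *)

Section Descent.
Variables (k : closedFieldType) (K : fieldExtType {fraction {poly k}}).
Implicit Types (X Y : K) (h f q : {poly k}) (D : K -> K^o).

(** The element [2 Y - h] is unchanged, hence the same [D] serves the translated model. *)
Lemma chart_translate X Y h f D q : chart X Y h f D ->
  chart X (Y - pev X q) (h - 2%:R *: q) (f + h * q - q ^+ 2) D.
Proof.
move=> XY; split.
- transitivity (Y ^+ 2 - 2%:R * pev X q * Y + pev X q ^+ 2); first by ring.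
  rewrite (chart_eq XY) !(rmorphB, rmorphD, rmorphM, rmorphXn) /= pevZ
    rmorph_nat.
  by ring.
- move=> z; have [u [v [c [c0 zE]]]] := chart_span XY z.
  by exists (u + v * q), v, c; split=> //; rewrite zE rmorphD rmorphM /=; ring.
- move=> u v E; have [|u0 v0] := chart_free XY (u := u - v * q) (v := v).
    by rewrite -[RHS]E rmorphB rmorphM /=; ring.
  by move: u0; rewrite v0 mul0r subr0.
- exact: chart_der XY.
- by rewrite (chart_DX XY) rmorphB /= pevZ rmorph_nat; ring.
- have [DD DM Dc] := chart_der XY.
  have -> : D (Y - pev X q) = D Y - D (pev X q).
    by apply/eqP; rewrite eq_sym subr_eq -DD subrK.
  rewrite (derivation_pev _ _ (chart_der XY)) (chart_DX XY) (chart_DY XY).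
  rewrite !derivE !(rmorphB, rmorphD, rmorphM, rmorphXn) /= !pevZ.
  rewrite ?rmorphMn /= ?rmorph_nat ?rmorphM /=.
  by ring.
Qed.

Lemma smooth_translate h f q (a : k) : smooth_at h f a ->
  smooth_at (h - 2%:R *: q) (f + h * q - q ^+ 2) a.
Proof.
move=> sm b; rewrite !derivE !hornerE /= => bE [E1 E2].
apply: (sm (b + q.[a])); last split.
- by transitivity (b ^+ 2 + 2%:R * b * q.[a] + q.[a] ^+ 2); [ring|rewrite bE;
  ring].
- by rewrite mulrDr E1 subrK.
- have E1' : 2%:R * (b + q.[a]) - h.[a] = 0 by rewrite mulrDr E1 subrK subrr.
  transitivity ((h^`().[a] - 2%:R * q^`().[a]) * b + (f^`().[a] + h^`().[a] *
    q.[a]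
    + h.[a] * q^`().[a] - (q^`().[a] * q.[a] + q.[a] * q^`().[a]))
    + (2%:R * (b + q.[a]) - h.[a]) * q^`().[a]); first by ring.
  by rewrite E1' mul0r addr0 -[RHS]E2; ring.
Qed.

Lemma coef1_deriv (R : nzSemiRingType) (p : {poly R}) : p^`().[0] = p`_1.
Proof. by rewrite horner_coef0 coef_deriv mulr1n. Qed.

(** The values and derivatives of [hinv] and [finv] at 0 are the two top coefficients of [h] and
    [f]. Subtracting [b x^(g+1)] moves the singular point [b] to the origin, which removes one
    coefficient of [h] and two of [f]. *)
Lemma translate_singular h f g :
  (size h <= g.+2)%N -> (size f <= (2 * g).+3)%N ->
  ~ smooth_at (hinv h g) (finv f g) 0 ->
  exists q, (size (h - 2%:R *: q)%R <= g.+1)%N /\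
    (size (f + h * q - q ^+ 2)%R <= (2 * g).+1)%N.
Proof.
move=> sh sf nsm.
have [b [bE b1 b2]] : exists b, [/\ b ^+ 2 = (hinv h g).[0] * b + (finv f
  g).[0],
    2%:R * b = (hinv h g).[0] &
    (hinv h g)^`().[0] * b + (finv f g)^`().[0] = 0].
  apply: contrapT => nb; apply: nsm => b bE [b1 b2].
  by apply: nb; exists b.
move: bE b1 b2; rewrite !coef1_deriv !horner_coef0 /hinv /finv !coef_revp /=.
rewrite !subn0 !subn1 /= => bE b1 b2.
pose q : {poly k} := b *: 'X^(g.+1).
have hq j : (h * q)`_j = if (j < g.+1)%N then 0 else b * h`_(j - g.+1).
  by rewrite /q -scalerAr coefZ coefMXn; case: ifP; rewrite ?mulr0.
have qq j : (q ^+ 2)`_j = if (j == 2 * g.+1)%N then b ^+ 2 else 0.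
  rewrite /q exprZn coefZ -exprM mulnC coefXn.
  by case: eqP; rewrite ?mulr1 ?mulr0.
exists q; split; apply/leq_sizeP => j jg.
  rewrite coefB coefZ coefZ coefXn; have [->|/eqP nj] := j =P g.+1.
    by rewrite mulr1 b1 subrr.
  by rewrite (leq_sizeP _ _ sh) ?mulr0 ?subr0//; lia.
rewrite coefB coefD hq qq (_ : (j < g.+1)%N = false); last by lia.
have [->|/eqP nj] := j =P (2 * g.+1)%N.
  rewrite (_ : (2 * g.+1 - g.+1)%N = g.+1); last by lia.
  by rewrite bE (_ : (2 * g.+1)%N = (2 * g).+2); [ring | lia].
have [->|/eqP nj'] := j =P (2 * g).+1.
  rewrite (_ : ((2 * g).+1 - g.+1)%N = g); last by lia.
  by rewrite -[RHS]b2; ring.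
by rewrite (leq_sizeP _ _ sf) ?(leq_sizeP _ _ sh) ?mulr0 ?addr0 ?subr0//; lia.
Qed.

(* A model of too large a [g], that is, one which is singular at infinity,
   becomes a model for [g - 1] by a translation of [Y]. *)
Lemma smooth_model X Y h f D g : chart X Y h f D ->
  2%:R * Y - pev X h != 0 ->
  (size h <= g.+2)%N -> (size f <= (2 * g).+3)%N ->
  (forall a, smooth_at h f a) ->
  exists g' Y' h' f', [/\ chart X Y' h' f' D, 2%:R * Y' - pev X h' != 0,
    (size h' <= g'.+2)%N /\ (size f' <= (2 * g').+3)%N,
    (forall a, smooth_at h' f' a) /\ smooth_at (hinv h' g') (finv f' g') 0 &
    (g' <= g)%N /\ (g' = g -> smooth_at (hinv h g) (finv f g) 0)].
Proof.
elim: g Y h f => [|g IH] Y h f XY sep sh sf sm.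
  have [smi|nsm] := pselect (smooth_at (hinv h 0) (finv f 0) 0).
    by exists 0%N, Y, h, f.
  (* For [g = 0] the translated equation has constant coefficients, so its roots are constants and
     [Y - q] would be one of them, against freeness. *)
  have [q [sh1 sf1]] := translate_singular sh sf nsm.
  have XY1 := chart_translate q XY.
  have h1 := size1_polyC sh1; have f1 := size1_polyC sf1.
  move: XY1; rewrite h1 f1; set Y1 := Y - pev X q; set c := _`_0; set d := _`_0.
  move=> XY1; have [b bE] := exists_fiber_root c%:P d%:P 0.
  have : (Y1 - cst K b) * (Y1 - cst K (c - b)) = 0.
    transitivity (Y1 ^+ 2 - cst K c * Y1 + cst K b * cst K c - cst K (b ^+ 2)).
      by rewrite rmorphB rmorphXn /=; ring.
    rewrite (chart_eq XY1) bE !hornerC !pevC rmorphD rmorphM /=; ring.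
  have nY e : Y1 - cst K e != 0.
    apply/eqP => E; have [|_ /eqP] := chart_free XY1 (u := - e%:P) (v := 1).
      by rewrite rmorphN rmorph1 /= pevC mul1r addrC.
    by rewrite oner_eq0.
  by move=> /eqP; rewrite mulf_eq0 (negPf (nY _)) (negPf (nY _)).
have [smi|nsm] := pselect (smooth_at (hinv h g.+1) (finv f g.+1) 0).
  by exists g.+1, Y, h, f.
have [q [sh1 sf1]] := translate_singular sh sf nsm.
have [||||g' [Y' [h' [f' [XY' sep' s' sm' [le' _]]]]]] :=
    IH _ _ _ (chart_translate q XY).
- have -> : 2%:R * (Y - pev X q) - pev X (h - 2%:R *: q) = 2%:R * Y - pev X h.
    by rewrite rmorphB /= pevZ rmorph_nat; ring.
  exact: sep.
- exact: sh1.
- by apply: leq_trans sf1 _; lia.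
- by move=> a; apply: smooth_translate.
exists g', Y', h', f'; split=> //; split; first by lia.
by move=> E; lia.
Qed.

End Descent.

(** * Derivations of the function field *)

Section Derivation.
Variables (k : closedFieldType) (K : fieldExtType {fraction {poly k}}).
Variables (X Y : K) (h f : {poly k}).
Hypothesis eqXY : Y ^+ 2 = pev X h * Y + pev X f.
Hypothesis span : forall z, exists u v c,
  c != 0 /\ z * pev X c = pev X u + pev X v * Y.
Hypothesis free : forall u v, pev X u + pev X v * Y = 0 -> u = 0 /\ v = 0.

Definition represents (z : K) (r : {poly k} * {poly k} * {poly k}) : Prop :=
  r.2 != 0 /\ z * pev X r.2 = pev X r.1.1 + pev X r.1.2 * Y.

Definition repr_of (z : K) : {poly k} * {poly k} * {poly k} :=
  projT1 (cid (let: ex_intro u (ex_intro v (ex_intro c P)) := span z in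
    ex_intro (represents z) (u, v, c) P)).

Lemma repr_ofP z : represents z (repr_of z).
Proof. exact: projT2 (cid _). Qed.

Local Notation E := (2%:R * Y - pev X h).
Local Notation G := (pev X h^`() * Y + pev X f^`()).

Definition der_num (u v : {poly k}) : K :=
  (pev X u^`() + pev X v^`() * Y) * E + pev X v * G.

(** The quotient rule for [(u + v Y) / c], with [E] and [G] as derivatives of [X] and [Y]. *)
Definition der_frac (r : {poly k} * {poly k} * {poly k}) : K :=
  (der_num r.1.1 r.1.2 * pev X r.2
   - (pev X r.1.1 + pev X r.1.2 * Y) * pev X r.2^`() * E) / pev X r.2 ^+ 2.

Definition der (z : K) : K^o := der_frac (repr_of z).

Lemma pev_neq0 c : c != 0 -> pev X c != 0.
Proof.
move=> c0; apply: contra_neq c0 => E0.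
by have [] := free (u := c) (v := 0); rewrite ?rmorph0 ?mul0r ?addr0.
Qed.

(** By freeness [c1 u = c u1] and [c1 v = c v1]; these identities and their derivatives eliminate
    the second representation. *)
Lemma derE z r : represents z r -> der z = der_frac r.
Proof.
suff H r1 r2 : represents z r1 -> represents z r2 -> der_frac r1 = der_frac r2.
  by apply: H; apply: repr_ofP.
case: r1 r2 => [[u v] c] [[u1 v1] c1] [/= c0 zE] [/= c10 zE1].
have p0 := pev_neq0 c0; have p10 := pev_neq0 c10.
have [uE vE] : c1 * u - c * u1 = 0 /\ c1 * v - c * v1 = 0.
  apply: free; rewrite !rmorphB !rmorphM /=.
  transitivity (pev X c1 * (pev X u + pev X v * Y)
    - pev X c * (pev X u1 + pev X v1 * Y)); first by ring.
  by rewrite -zE -zE1; ring.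
have lift (p q : {poly k}) : c1 * p - c * q = 0 ->
    pev X c1 * pev X p = pev X c * pev X q /\
    pev X c1^`() * pev X p + pev X c1 * pev X p^`() =
    pev X c^`() * pev X q + pev X c * pev X q^`().
  move/eqP; rewrite subr_eq0 => /eqP pq; split.
    by rewrite -!rmorphM pq.
  by have := congr1 (pev X \o deriv) pq; rewrite /= !derivM !rmorphD !rmorphM.
have [uE0 uE1] := lift _ _ uE; have [vE0 vE1] := lift _ _ vE.
have u1E : pev X u1 = pev X c1 * pev X u / pev X c by rewrite uE0 mulrC mulKf.
have v1E : pev X v1 = pev X c1 * pev X v / pev X c by rewrite vE0 mulrC mulKf.
have u1'E : pev X u1^`() = (pev X c1^`() * pev X u + pev X c1 * pev X u^`()
    - pev X c^`() * pev X u1) / pev X c.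
  by rewrite uE1 addrAC subrr add0r mulrC mulKf.
have v1'E : pev X v1^`() = (pev X c1^`() * pev X v + pev X c1 * pev X v^`()
    - pev X c^`() * pev X v1) / pev X c.
  by rewrite vE1 addrAC subrr add0r mulrC mulKf.
rewrite /der_frac /der_num /= u1'E v1'E u1E v1E; field.
by rewrite p0 p10.
Qed.

Let deriv1 : (1 : {poly k})^`() = 0.
Proof. by rewrite -polyC1 derivC. Qed.

Lemma der_pev p : der (pev X p) = pev X p^`() * E.
Proof.
rewrite (derE (r := (p, 0, 1))); last first.
  by split; [exact: oner_neq0 | rewrite /= rmorph1 rmorph0 mul0r addr0 mulr1].
rewrite /der_frac /der_num /= deriv0 deriv1 !rmorph0 rmorph1.
by rewrite expr1n divr1; ring.
Qed.

Lemma der_chart : chart X Y h f der.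
Proof.
split=> //.
- split.
  + move=> a b; case: (repr_of a) (repr_ofP a) (erefl (repr_of a)).
    move=> [u v] c Ra _; move: (repr_ofP b);
      case: (repr_of b) => [[u1 v1] c1] Rb.
    rewrite (derE Ra) (derE Rb).
    case: Ra Rb => [/= c0 aE] [/= c10 bE].
    have p0 := pev_neq0 c0; have p10 := pev_neq0 c10.
    rewrite (derE (r := (u * c1 + u1 * c, v * c1 + v1 * c, c * c1)));
      last first.
      split; first by rewrite mulf_neq0.
      rewrite /= !(rmorphD, rmorphM) /=.
      transitivity ((a * pev X c) * pev X c1 + (b * pev X c1) * pev X c).
        by ring.
      by rewrite aE bE; ring.
    rewrite /der_frac /der_num /= !derivE !(rmorphD, rmorphM) /=.
    by field; rewrite p0 p10.
  + move=> a b; move: (repr_ofP a); case: (repr_of a) => [[u v] c] Ra.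
    move: (repr_ofP b); case: (repr_of b) => [[u1 v1] c1] Rb.
    rewrite (derE Ra) (derE Rb).
    case: Ra Rb => [/= c0 aE] [/= c10 bE].
    have p0 := pev_neq0 c0; have p10 := pev_neq0 c10.
    have aE' : a = (pev X u + pev X v * Y) / pev X c by rewrite -aE mulfK.
    have bE' : b = (pev X u1 + pev X v1 * Y) / pev X c1 by rewrite -bE mulfK.
    have fE : pev X f = Y ^+ 2 - pev X h * Y by rewrite eqXY addrC addKr.
    rewrite (derE (r := (u * u1 + v * v1 * f, u * v1 + v * u1 + v * v1 * h, c *
      c1)));
      last first.
      split; first by rewrite mulf_neq0.
      rewrite /= !(rmorphD, rmorphM) /= fE aE' bE'.
      by field; rewrite p0 p10.
    rewrite /der_frac /der_num /= !derivE !(rmorphD, rmorphM) /= fE aE' bE'.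
    rewrite /GRing.scale /=.
    by field; rewrite p0 p10.
  + by move=> c; rewrite -(pevC X) der_pev derivC rmorph0 mul0r.
- by rewrite -{1}(pevX X) der_pev derivX rmorph1 mul1r.
- rewrite (derE (r := (0, 1, 1))); last first.
    by split; [exact: oner_neq0 | rewrite /= rmorph1 rmorph0 mul1r add0r mulr1].
  rewrite /der_frac /der_num /= deriv0 deriv1 !rmorph0 rmorph1.
  by rewrite expr1n divr1; ring.
Qed.

End Derivation.

(** * The Kaehler differentials as a line with coordinate [phi] *)

Section Universal.
Variables (k : closedFieldType) (K : fieldExtType {fraction {poly k}}).
Variables (X Y : K) (h f : {poly k}) (D : K -> K^o).
Hypothesis XY : chart X Y h f D.
Hypothesis sep : 2%:R * Y - pev X h != 0.

(** The equation gives [(2 Y - h) d Y = 0], so [d Y = 0] by separability, and [d] vanishes on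
    quotients. *)
Lemma derivation_eq0 (M : lmodType K) (d : K -> M) :
  is_derivation d -> d X = 0 -> forall z, d z = 0.
Proof.
move=> [dD dM dc] dX.
have d0 : d 0 = 0 by rewrite -(rmorph0 (cst K)) dc.
have dp p : d (pev X p) = 0.
  elim/poly_ind: p => [|p c IH]; first by rewrite rmorph0.
  by rewrite rmorphD rmorphM /= pevC pevX dD dM IH dX dc !scaler0 !addr0.
have dY : d Y = 0.
  have := congr1 d (chart_eq XY); rewrite expr2 dD !dM !dp scaler0 !addr0.
  move=> E; have : (2%:R * Y - pev X h) *: d Y = 0.
    by rewrite scalerBl mulrDl mul1r scalerDl E subrr.
  by move/eqP; rewrite scaler_eq0 (negPf sep) => /eqP.
move=> z; have [u [v [c [c0 zE]]]] := chart_span XY z.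
have pc : pev X c != 0 by apply: contra_neq c0 => /(chart_pev_eq0 XY).
have := congr1 d zE; rewrite dD !dM !dp dY !scaler0 !addr0 add0r.
by move/eqP; rewrite scaler_eq0 (negPf pc) => /eqP.
Qed.

(** [diff z - D z *: eta] is a derivation that kills [X], hence zero; so [eta] spans the
    differentials and [phi] is injective. *)
Lemma kaehler_coordinate (Om : kaehler K) : exists phi : Om -> K,
  [/\ forall v w, phi (v + w) = phi v + phi w,
      forall a w, phi (a *: w) = a * phi w,
      forall z, phi (diff Om z) = D z &
      injective phi].
Proof.
have [phi phid _] := diff_universal Om (chart_der XY).
have phiZ a w : phi (a *: w) = a * phi w by rewrite linearZ.
exists phi; split=> //; first exact: raddfD.
pose eta := (D X)^-1 *: diff Om X.
have DX0 : D X != 0 by rewrite (chart_DX XY).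
have [dD dM dc] := diff_der Om; have [DD DM Dc] := chart_der XY.
have dE z : diff Om z = D z *: eta.
  apply/eqP; rewrite -subr_eq0; apply/eqP.
  apply: (derivation_eq0 (d := fun z => diff Om z - D z *: eta)).
    split=> [a b|a b|c].
    - by rewrite dD DD scalerDl opprD addrACA.
    - rewrite dM DM scalerDl -!scalerA opprD addrACA -!scalerBr.
      by rewrite /GRing.scale.
    - by rewrite dc Dc scale0r subr0.
  by rewrite /eta scalerA mulfV// scale1r subrr.
have lin : linear (fun w : Om => phi w *: eta).
  by move=> a v w; rewrite raddfD /= phiZ scalerDl -scalerA.
pose psi : {linear Om -> Om} := HB.pack (fun w : Om => phi w *: eta)
  (GRing.isLinear.Build K Om Om *:%R (fun w : Om => phi w *: eta) lin).
have [chi _ uniq] := diff_universal Om (diff_der Om).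
(* The identity and [psi] both carry [diff] to itself, so they agree by uniqueness. *)
have phiE w : w = phi w *: eta.
  transitivity (chi w); first exact: (uniq idfun (fun=> erefl) w).
  by symmetry; apply: (uniq psi) => a; rewrite /= phid -dE.
by move=> v w E; rewrite (phiE v) (phiE w) E.
Qed.

End Universal.

(** * The hyperelliptic curve *)

Section FunctionField.
Variables (k : closedFieldType) (K : fieldExtType {fraction {poly k}}).
Local Notation x := (xK K).

Lemma evxE p : evx K p = pev x p.
Proof.
elim/poly_ind: p => [|p c IH]; first by rewrite !rmorph0.
by rewrite !rmorphD !rmorphM /= IH pevX pevC.
Qed.

Lemma fracP (R : idomainType) (r : {fraction R}) :
  exists n d : R, d != 0 /\ r * FracField.tofrac d = FracField.tofrac n.
Proof.
elim/quotW: r => r; exists (frac r).1, (frac r).2; split.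
  exact: denom_ratioP.
rewrite /GRing.mul /= !piE; apply/eqmodP.
rewrite /= /FracField.equivf /FracField.mulf /=.
by rewrite !numden_Ratio ?mulf_neq0 ?denom_ratioP ?oner_neq0// !mulr1 mulrC.
Qed.

Lemma evx_neq0 p : p != 0 -> evx K p != 0.
Proof. by move=> p0; rewrite /evx /= scaler_eq0 oner_eq0 orbF tofrac_eq0. Qed.

Lemma evx_1 p : evx K p \in 1%VS.
Proof. exact: memvZ (memv_line 1). Qed.

Lemma mem1P z : z \in (1%VS : {vspace K}) ->
  exists n d, d != 0 /\ z * evx K d = evx K n.
Proof.
move=> /vlineP[r ->]; have [n [d [d0 E]]] := fracP r.
exists n, d; split=> //; rewrite /evx /= -E.
by rewrite -scalerAl mul1r scalerA.
Qed.

(** * Consequences of degree two and separability *)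

Section Generator.
Variables (y : K) (h f : {poly k}).
Hypothesis (Khyp : hyperelliptic K) (Ky : <<1; y>>%VS = {:K}%VS).
Hypothesis yE : y ^+ 2 = pev x h * y + pev x f.

Lemma adjoin_degree_y : adjoin_degree 1 y = 2%N.
Proof.
case: Khyp => dimK _.
by have := dim_Fadjoin 1 y; rewrite Ky dimK dimv1 muln1.
Qed.

Lemma y_notin1 : y \notin (1%VS : {vspace K}).
Proof.
apply/negP => /Fadjoin_idP E; case: Khyp.
by rewrite -Ky E dimv1.
Qed.

Lemma hyperelliptic_free u v : pev x u + pev x v * y = 0 -> u = 0 /\ v = 0.
Proof.
rewrite -!evxE => E; have v0 : v = 0.
  apply/eqP; apply: contraNT y_notin1 => v0.
  have -> : y = - evx K u / evx K v.
    apply: (mulfI (evx_neq0 v0)); rewrite mulrCA mulfV ?evx_neq0// mulr1.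
    by apply/eqP; rewrite -addr_eq0 addrC E.
  by apply: (memvM (A := 1%AS)); rewrite ?memvN ?evx_1// memvV evx_1.
split=> //; apply/eqP; apply: contraTT (eqxx (0 : K)) => u0.
by rewrite -{1}E v0 rmorph0 mul0r addr0 evx_neq0.
Qed.

Lemma hyperelliptic_span z : exists u v c,
  c != 0 /\ z * pev x c = pev x u + pev x v * y.
Proof.
have : z \in <<1; y>>%VS by rewrite Ky memvf.
move=> /Fadjoin_poly_eq; set p := Fadjoin_poly _ _ _ => pE.
have sp : (size p <= 2)%N by rewrite -adjoin_degree_y; exact: size_Fadjoin_poly.
have p1 i : p`_i \in (1%VS : {vspace K}).
  by have /polyOverP := Fadjoin_polyOver 1 y z; apply.
have [n0 [d0 [d00 E0]]] := mem1P (p1 0%N).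
have [n1 [d1 [d10 E1]]] := mem1P (p1 1%N).
exists (n0 * d1), (n1 * d0), (d0 * d1); split; first by rewrite mulf_neq0.
rewrite !rmorphM /= -!evxE -E0 -E1 -pE (horner_coef_wide _ sp).
by rewrite !big_ord_recl big_ord0 /=; ring.
Qed.

(** If [2 y = h], freeness gives [h = 0] and [2 = 0]; then [y^2] is in [k(x)], and [y] would be both
    separable and purely inseparable over it without lying in it. *)
Lemma hyperelliptic_separable : 2%:R * y - pev x h != 0.
Proof.
apply/eqP => E.
have [|h0 two0] := @hyperelliptic_free (- h) 2%:R.
  by rewrite rmorphN rmorph_nat addrC.
have {}two0 : 2%:R = 0 :> K.
  by rewrite -(rmorph_nat (pev x)) two0 rmorph0.
have {}h0 : h = 0 by apply/eqP; rewrite -oppr_eq0 h0.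
have chK : 2%N \in [pchar K] by rewrite inE /= two0.
have y2 : y ^+ 2 \in (1%VS : {vspace K}).
  by rewrite yE h0 rmorph0 mul0r add0r -evxE evx_1.
have insep : purely_inseparable_element 1 y.
  by apply/purely_inseparable_elementP_pchar; exists 2%N; rewrite ?pnatE.
have [_ /separableP/(_ y (memvf y)) sepy] := Khyp.
by have := separable_inseparable_element 1 y;
  rewrite sepy insep (negPf y_notin1).
Qed.

End Generator.
End FunctionField.

(** * The given equation is a smooth model *)

Section Model.
Variables (k : closedFieldType) (K : fieldExtType {fraction {poly k}}).
Local Notation x := (xK K).
Variables (Om : kaehler K) (g : nat) (y : K) (h f : {poly k}).
Hypothesis (Khyp : hyperelliptic K) (Ky : <<1; y>>%VS = {:K}%VS).
Hypothesis (genus : has_genus Om g).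
Hypothesis yE : y ^+ 2 = pev x h * y + pev x f.
Hypothesis smooth_fin : forall a, smooth_at h f a.
Hypothesis (sh : (size h <= g.+2)%N) (sf : (size f <= (2 * g).+3)%N).

(** The descent yields a smooth model for some [g' <= g] with the same [D] and [phi]. The dimension
    of the global differentials gives [g' = g], so the given model is already smooth at infinity. *)
Lemma curve_model : exists (D : K -> K^o) (phi : Om -> K),
  [/\ chart x y h f D, 2%:R * y - pev x h != 0,
      smooth_at (hinv h g) (finv f g) 0 &
  [/\ forall v w, phi (v + w) = phi v + phi w,
      forall a w, phi (a *: w) = a * phi w,
      forall z, phi (diff Om z) = D z &
      injective phi]].
Proof.
have [D xy] : exists D : K -> K^o, chart x y h f D.
  eexists; exact: (der_chart yE (hyperelliptic_span Khyp Ky)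
    (hyperelliptic_free Khyp Ky)).
have sep := hyperelliptic_separable Khyp Ky yE.
have [phi [phiD phiZ phid phi_inj]] := kaehler_coordinate xy sep Om.
exists D, phi; split=> //.
have [g' [y' [h' [f' [xy' sep' [sh' sf'] [sm smi] [_ gg']]]]]] :=
  smooth_model xy sep sh sf smooth_fin.
apply: gg'; symmetry.
have DX0 : D x != 0 by rewrite (chart_DX xy).
apply: (has_genus_unique xy' sep' sh' sf' sm smi phiD phiZ phid phi_inj
  (eta := (D x)^-1 *: diff Om x)) => //.
by rewrite phiZ phid mulVf.
Qed.

Variables (e : k) (gamma lambda : nat -> triple Om).
Hypothesis e0 : e != 0.
Hypothesis gammaE : forall i, exists w0 woo,
  gamma i = mktriple (w0 *: diff Om x) (woo *: diff Om x) (y / x ^+ i) /\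
  w0 * (2%:R * y - pev x h) =
    (pev x (upto i (s_ f i)) + pev x (upto i (s_y h i)) * y) / x ^+ i.+1 /\
  woo * (2%:R * y - pev x h) =
    - ((pev x (above i (s_ f i)) + pev x (above i (s_y h i)) * y) / x ^+ i.+1).
Hypothesis lambdaE : forall i, exists w,
  lambda i = mktriple (w *: diff Om x) (w *: diff Om x) 0 /\
  w * (2%:R * y - pev x h) = cst K e * x ^+ i.

(** The coordinate of [a dx] is [a (2 y - h)]. The scalar [e] will be 2 when [p <> 2], since
    [dx / y = 2 eta], and 1 when [p = 2]. *)
Lemma model_basis : classes_form_basis g gamma lambda.
Proof.
have [D [phi [xy sep smi [phiD phiZ phid phi_inj]]]] := curve_model.
have phiE a : phi (a *: diff Om x) = a * (2%:R * y - pev x h).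
  by rewrite phiZ phid (chart_DX xy).
have [w wE] := choice lambdaE.
apply: (basis_H1dR xy sep sh sf smooth_fin smi phiD phiZ phid phi_inj
  (w := fun i => w i *: diff Om x) e0) => [i|i|i|i].
- have [w0 [woo [-> [E0 Eoo]]]] := gammaE i.+1.
  by apply: (gamma_cocycle xy sep sh sf smooth_fin smi phiD phiZ phid phi_inj);
    rewrite ?phiE.
- by have [w0 [woo [-> _]]] := gammaE i.+1.
- by have [] := wE i.
- by rewrite phiE; have [] := wE i.
Qed.

End Model.

(** * The defining equations in characteristic different from 2 and equal to 2 *)

Lemma smooth_at_squarefree (k : closedFieldType) (f : {poly k}) (a : k) :
  2%:R != 0 :> k -> ~~ (('X - a%:P) ^+ 2 %| f) -> smooth_at 0 f a.
Proof.
move=> two0 sqf b; rewrite !deriv0 !horner0 !mul0r !add0r => bE [/eqP].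
rewrite mulf_eq0 (negPf two0) /= => /eqP b0 f'a.
(* A singular point has [b = 0], so [f] and [f'] both vanish at [a], which makes [a] a double
   root. *)
apply: (negP sqf); have [q fE] := poly_split f a.
move: fE; rewrite -bE b0 expr0n addr0 => fE.
have [r qE] := poly_split q a.
have qa : q.[a] = 0 by rewrite -f'a fE !derivE !hornerE; ring.
by rewrite fE qE qa addr0 mulrA -expr2 dvdp_mulr.
Qed.

Theorem theorem2p2 (k : closedFieldType) (K : fieldExtType {fraction {poly k}})
    (Om : kaehler K) (g : nat) (y : K) :
  hyperelliptic K -> has_genus Om g -> (2 <= g)%N ->
  (2%N \notin [pchar k] ->
     forall f : {poly k}, defining_eq g y f ->
       classes_form_basis g (gamma_triple Om y f) (lambda_triple Om y)) /\
  (2%N \in [pchar k] ->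
     forall h f : {poly k}, defining_eq2 g y h f ->
       classes_form_basis g (gamma2_triple Om y h f) (lambda2_triple Om h)).
Proof.
move=> Khyp genus _; have cst2 : 2%:R = cst K 2%:R by rewrite rmorph_nat.
split=> [ch2 f [Ky yE _ sqf [sf1 sf2]] | ch2 h f [Ky yE sm sf [sh _]]].
  have two0 : 2%:R != 0 :> k by apply: contra ch2; rewrite inE.
  have two0K : 2%:R != 0 :> K by rewrite cst2 fmorph_eq0.
  have yE' : y ^+ 2 = pev (xK K) 0 * y + pev (xK K) f.
    by rewrite rmorph0 mul0r add0r -evxE.
  have sm a : smooth_at 0 f a by apply: smooth_at_squarefree.
  have sf : (size f <= (2 * g).+3)%N.
    by have [/sf1->|/sf2->] := pselect (branch_point K (infty k)); lia.
  have s0 : (size (0%R : {poly k}) <= g.+2)%N by rewrite size_poly0.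
  have x0 : xK K != 0.
    by have := evx_neq0 K (negbT (polyX_eq0 k)).
  have y0 : y != 0.
    by apply: contraNneq (y_notin1 Khyp Ky) => ->; rewrite mem0v.
  have sy i : s_y (0 : {poly k}) i = 0 by rewrite /s_y deriv0 mulr0 scaler0
    subr0.
  apply: (model_basis Khyp Ky genus yE' sm s0 sf two0) => i.
    exists (psi_ K f i / (2%:R * xK K ^+ i.+1 * y)),
      (- phi_ K f i / (2%:R * xK K ^+ i.+1 * y)); split=> //.
    have trunc0 : upto i (0 : {poly k}) = 0 /\ above i (0 : {poly k}) = 0.
      by split; apply/polyP => j; rewrite coef_poly !coef0 !if_same.
    rewrite sy trunc0.1 trunc0.2 !rmorph0 /psi_ /phi_ !evxE.
    by split; field; rewrite ?two0K ?y0 ?expf_neq0 ?x0.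
  exists (xK K ^+ i / y); split=> //.
  by rewrite rmorph0 subr0 -cst2; field.
have two0 : 2%:R = 0 :> k by move: ch2; rewrite inE => /andP[_ /eqP].
have two0K : 2%:R = 0 :> K by rewrite cst2 two0 rmorph0.
(* Signs disappear in characteristic 2; this identifies [s2_] with the pair [s_], [s_y] and
   reconciles the signs of the triples. *)
have opp2 (R : pzRingType) (z : R) : 2%:R = 0 :> R -> - z = z.
  by move=> R2; apply/eqP; rewrite eq_sym -addr_eq0 -mulr2n -mulr_natl R2 mul0r.
have oppK (z : K) : - z = z by apply: opp2.
have oppk (c : k) : - c = c by apply: opp2.
have yE' : y ^+ 2 = pev (xK K) h * y + pev (xK K) f.
  by rewrite -!evxE -yE addrC subrK.
(* At a singular point [h(a) = 0] and [f(a) = b^2], so [h'^2 f + f'^2] takes the value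
   [(h' b + f')^2 = 0] at [a]: a common root with [h]. *)
have smf a : smooth_at h f a.
  move=> b bE [E1 E2]; have ha : h.[a] = 0 by rewrite -E1 two0 mul0r.
  apply: (sm a); split; last by rewrite /root ha.
  rewrite /root !hornerE /=; apply/eqP.
  have fE : f.[a] = b ^+ 2 by rewrite bE ha mul0r add0r.
  transitivity ((h^`().[a] * b + f^`().[a]) ^+ 2
    - 2%:R * h^`().[a] * b * f^`().[a]); first by rewrite fE; ring.
  by rewrite E2 two0 !mul0r subr0 expr0n.
have h0 : evx K h != 0.
  have := hyperelliptic_separable Khyp Ky yE'.
  by rewrite two0K mul0r sub0r oppr_eq0 evxE.
have x0 : xK K != 0 by have := evx_neq0 K (negbT (polyX_eq0 k)).
have sh' : (size h <= g.+2)%N by move: sh; rewrite addn1.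
have sf' : (size f <= (2 * g).+3)%N by move: sf; rewrite addn2.
have sE i : s_ f i = (s2_ h f i).1.
  by rewrite /s_ /= natrM two0 mul0r scale0r subr0.
have syE i : s_y h i = (s2_ h f i).2.
  by rewrite /s_y /= -scaleNr oppk.
have e0 : (1 : k) != 0 by apply: oner_neq0.
apply: (model_basis Khyp Ky genus yE' smf sh' sf' e0) => i.
  exists (psi2_ y h f i / (xK K ^+ i.+1 * evx K h)),
    (phi2_ y h f i / (xK K ^+ i.+1 * evx K h)); split=> //.
  rewrite two0K mul0r sub0r -evxE !oppK sE syE /psi2_ /phi2_ -!evxE.
  by split; field; rewrite ?h0 ?expf_neq0 ?x0.
exists (xK K ^+ i / evx K h); split=> //.
by rewrite two0K mul0r sub0r -evxE oppK rmorph1; field.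
Qed.
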